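(* Suppose $\beta$ lies in the low temperature phase. Then there is a constant $a>0$ such that for all sufficiently large $n$ the mixing time of the Glauber dynamics for $p_n$ is at least $e^{an}$. Moreover the same conclusion holds for any local Markov chain on $\mathcal G_n$ with stationary distribution $p_n$, i.e. any such chain for which every transition changes at most $f(n)$ edges, where $f(n)=o(n)$.
   Context: Fix an integer $s\ge 1$, and graphs $G_1,\dots,G_s$, where $G_i$ has vertex set $V_i=\{1,\dots,|V_i|\}$ and edge set $E_i$; $G_1$ is the graph with vertex set $\{1,2\}$ and the single edge $\{1,2\}$. Fix $\beta=(\beta_1,\dots,\beta_s)$ with $\beta_1\in\mathbb R$ and $\beta_i>0$ for $i\ge 2$. Let $\mathcal G_n$ be the set of simple graphs on vertex set $[n]$, identified with $\{0,1\}^{\binom{[n]}{2}}$. For a fixed graph $G=(V,E)$ with $V=\{1,\dots,m\}$ and $X\in\mathcal G_n$, let $N_G(X)$ be the number of injective maps $\sigma:V\to[n]$ such that $\{\sigma(i),\sigma(j)\}\in X$ for every $\{i,j\}\in E$. The Gibbs measure is $p_n(X)=Z_n^{-1}\exp(H(X))$ with $H(X)=\sum_{i=1}^s\beta_i N_{G_i}(X)/n^{|V_i|-2}$. For $X\in\mathcal G_n$ and a pair $e$, $X_{e+}=X\cup\{e\}$, $X_{e-}=X\setminus\{e\}$, $\partial_eH(X)=H(X_{e+})-H(X_{e-})$. The Glauber dynamics, from state $X$, picks $e$ uniformly among the $\binom n2$ pairs and moves to $X_{e+}$ with probability $e^{\partial_eH(X)}/(1+e^{\partial_eH(X)})$ and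 to $X_{e-}$ otherwise. The mixing time is the least $t$ such that from every starting state the law at time $t$ is within total variation distance $e^{-1}$ of stationarity. Define $\Psi(p)=\sum_{i=1}^s 2\beta_i|E_i|p^{|E_i|-1}$ and $\varphi(p)=e^{\Psi(p)}/(1+e^{\Psi(p)})$ on $[0,1]$. $\beta$ is in the low temperature phase if the equation $\varphi(p)=p$ has at least two solutions $p\in[0,1]$ with $\varphi'(p)<1$. *)

(* Defs.v *)
From Stdlib Require Import Reals ZArith.
From mathcomp Require Import all_boot.

Unset Printing Implicit Defensive.
Open Scope R_scope.

Definition rsum {T : finType} (F : T -> R) : R :=
  List.fold_right (fun x acc => (F x + acc)) 0 (enum T).

Definition rsum_nat (s : nat) (F : nat -> R) : R :=
  List.fold_right (fun i acc => (F i + acc)) 0 (iota 0 s).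

Record sgraph := SGraph { gv : nat ; gadj : rel 'I_gv }.

Definition simple_graph (G : sgraph) : Prop :=
  (forall i j, @gadj G i j = @gadj G j i) /\ (forall i, @gadj G i i = false).

Definition num_edges (G : sgraph) : nat :=
  #|[set p : 'I_(gv G) * 'I_(gv G) | (nat_of_ord p.1 < nat_of_ord p.2)%N && @gadj G p.1 p.2]|.

Definition K2 : sgraph := @SGraph 2 (fun i j => i != j).

(* unordered pairs {u,v} of [n], represented as (u,v) with u < v *)
Notation pair_t n := {p : 'I_n * 'I_n | (nat_of_ord p.1 < nat_of_ord p.2)%N}.

Notation graph_t n := {set pair_t n}.

Definition adj {n : nat} (X : graph_t n) (u v : 'I_n) : bool :=
  [exists e : pair_t n, (e \in X) &&
     ((((val e).1 == u) && ((val e).2 == v)) || (((val e).1 == v) && ((val e).2 == u)))].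

Definition hom_count {n : nat} (G : sgraph) (X : graph_t n) : nat :=
  #|[set sigma : {ffun 'I_(gv G) -> 'I_n} |
      injectiveb sigma &&
      [forall i, forall j, @gadj G i j ==> adj X (sigma i) (sigma j)]]|.

Definition hamiltonian (n s : nat) (G : nat -> sgraph) (beta : nat -> R)
  (X : graph_t n) : R :=
  rsum_nat s (fun i => (beta i * INR (hom_count (G i) X)
                         / powerRZ (INR n) (Z.of_nat (gv (G i)) - 2))).

Definition partition_fn (n s : nat) G beta : R :=
  rsum (fun X : graph_t n => exp (hamiltonian n s G beta X)).

Definition gibbs (n s : nat) G beta (X : graph_t n) : R :=
  (exp (hamiltonian n s G beta X) / partition_fn n s G beta).

Definition logistic (x : R) : R := (exp x / (1 + exp x)).

Definition dH (n s : nat) G beta (X : graph_t n) (e : pair_t n) : R :=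
  (hamiltonian n s G beta (e |: X) - hamiltonian n s G beta (X :\ e)).

Definition glauber (n s : nat) G beta (X Y : graph_t n) : R :=
  rsum (fun e : pair_t n =>
    (/ INR #|{: pair_t n}| *
      ((if Y == e |: X then logistic (dH n s G beta X e) else 0)
       + (if Y == X :\ e then 1 - logistic (dH n s G beta X e) else 0)))).

Definition is_markov {T : finType} (P : T -> T -> R) : Prop :=
  (forall x y, 0 <= P x y) /\ (forall x, rsum (fun y => P x y) = 1).

Definition stationary {T : finType} (P : T -> T -> R) (pi : T -> R) : Prop :=
  forall y, rsum (fun x => (pi x * P x y)) = pi y.

Fixpoint law {T : finType} (P : T -> T -> R) (t : nat) (x : T) : T -> R :=
  match t with
  | 0 => fun y => if y == x then 1 else 0
  | t'.+1 => fun y => rsum (fun z => (law P t' x z * P z y))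
  end.

Definition tv_dist {T : finType} (mu nu : T -> R) : R :=
  (/ 2 * rsum (fun y => Rabs (mu y - nu y))).

Definition mixed_at {T : finType} (P : T -> T -> R) (pi : T -> R) (t : nat) : Prop :=
  forall x, (tv_dist (law P t x) pi <= exp (-1)).

Definition is_mixing_time {T : finType} (P : T -> T -> R) (pi : T -> R) (t : nat) : Prop :=
  mixed_at P pi t /\ (forall t', (t' < t)%N -> ~ mixed_at P pi t').

Definition local_chain {n : nat} (P : graph_t n -> graph_t n -> R) (k : nat) : Prop :=
  forall X Y, (0 < P X Y) -> (#|(X :\: Y) :|: (Y :\: X)| <= k)%N.

Definition little_o_n (f : nat -> nat) : Prop :=
  forall eps : R, (0 < eps) ->
    exists N : nat, forall n : nat, (N <= n)%N -> (INR (f n) <= eps * INR n).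

Definition Psi (s : nat) (G : nat -> sgraph) (beta : nat -> R) (p : R) : R :=
  rsum_nat s (fun i => (2 * beta i * INR (num_edges (G i)) * p ^ (num_edges (G i) - 1))).

Definition phi_fn (s : nat) G beta (p : R) : R := logistic (Psi s G beta p).

Definition stable_fixed_point (s : nat) G beta (p : R) : Prop :=
  (0 <= p <= 1) /\ phi_fn s G beta p = p /\
  exists d : R, derivable_pt_lim (phi_fn s G beta) p d /\ (d < 1).

Definition low_temperature (s : nat) G beta : Prop :=
  exists p1 p2 : R, p1 <> p2 /\ stable_fixed_point s G beta p1 /\ stable_fixed_point s G beta p2.

(* Main.v *)
(* Write D_e for the discrete derivative of H at the pair e; apart from the constant
   contribution of K2 it is increasing in the graph. The two stable fixed points
   p1 < p2 give p1 < q1 < q2 < p2 with phi(q1) < q1 and phi(q2) > q2, that is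
   Psi(q1) < h1 := ln (q1/(1-q1)) and h2 := ln (q2/(1-q2)) < Psi(q2). The bottleneck
   sets are A1 = {D_e <= h1 for all e} and A2 = {D_e >= h2 for all e}; they are
   disjoint since h1 < h2.

   On A1 adding an edge multiplies exp H by at most q1/(1-q1), and A1 is closed under
   removing edges. So the Gibbs measure conditioned on A1 has a decreasing density
   with respect to the Erdos-Renyi measure of density q1, and by Harris' inequality
   it gives every increasing event at most its Erdos-Renyi probability. Under the
   latter D_e has mean Psi(q1) + O(1/n) < h1, and it has bounded differences that are
   O(1/n) with sum O(1), so D_e >= h1 - o(1) has probability exp(-cn). But every
   graph of A1 from which o(n) changes lead out of A1 satisfies this for some e.
   Hence a local stationary chain started from the Gibbs measure on A1 needs
   exponentially long to leave A1; complementing graphs gives the same for A2, and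
   A1, A2 cannot both have Gibbs measure more than 1/2. *)

From HB Require Import structures.
Require Import Defs.
From Stdlib Require Import Reals ZArith Lra Lia.
From mathcomp Require Import all_boot.
Open Scope R_scope.

(** * Real sums as big operators *)

HB.instance Definition _ := Monoid.isComLaw.Build R 0 Rplus
  (fun x y z => esym (Rplus_assoc x y z)) Rplus_comm Rplus_0_l.
HB.instance Definition _ := Monoid.isMulLaw.Build R 0 Rmult Rmult_0_l Rmult_0_r.
HB.instance Definition _ := Monoid.isAddLaw.Build R Rmult Rplus
  Rmult_plus_distr_r Rmult_plus_distr_l.

Lemma rsumE {T : finType} (F : T -> R) : rsum F = \big[Rplus/0]_x F x.
Proof.
by rewrite /rsum -big_enum; elim: (enum T) => [|x l IH] /=; rewrite ?big_nil ?big_cons ?IH.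
Qed.

Lemma rsum_natE (s : nat) (F : nat -> R) :
  rsum_nat s F = \big[Rplus/0]_(i < s) F i.
Proof.
rewrite -(big_mkord xpredT) /index_iota subn0 /rsum_nat.
by elim: (iota 0 s) => [|x l IH] /=; rewrite ?big_nil ?big_cons ?IH.
Qed.

Lemma bigR_ge0 {I : Type} (r : seq I) (P : pred I) (F : I -> R) :
  (forall i, P i -> 0 <= F i) -> 0 <= \big[Rplus/0]_(i <- r | P i) F i.
Proof. by move=> H; apply: big_ind => // [|x y]; lra. Qed.

Lemma bigR_le {I : Type} (r : seq I) (P : pred I) (F G : I -> R) :
  (forall i, P i -> F i <= G i) ->
  \big[Rplus/0]_(i <- r | P i) F i <= \big[Rplus/0]_(i <- r | P i) G i.
Proof.
by move=> H; apply: (big_ind2 (fun x y => x <= y)) => // [|x y z t]; lra.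
Qed.

Lemma bigR_opp {I : Type} (r : seq I) (P : pred I) (F : I -> R) :
  \big[Rplus/0]_(i <- r | P i) - F i = - \big[Rplus/0]_(i <- r | P i) F i.
Proof.
by apply: (big_ind2 (fun x y => x = - y)) => // [|x y z t]; lra.
Qed.

Lemma bigR_sub {I : Type} (r : seq I) (P : pred I) (F G : I -> R) :
  \big[Rplus/0]_(i <- r | P i) (F i - G i) =
  \big[Rplus/0]_(i <- r | P i) F i - \big[Rplus/0]_(i <- r | P i) G i.
Proof. by rewrite /Rminus big_split /= bigR_opp. Qed.

Lemma bigR_abs {I : Type} (r : seq I) (P : pred I) (F : I -> R) :
  Rabs (\big[Rplus/0]_(i <- r | P i) F i) <= \big[Rplus/0]_(i <- r | P i) Rabs (F i).
Proof.
apply: (big_ind2 (fun x y => Rabs x <= y)) => //; first by rewrite Rabs_R0; lra.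
  by move=> x y z t Hx Hz; have := Rabs_triang x z; lra.
by move=> i _; apply: Rle_refl.
Qed.

Lemma bigR_mask {I : Type} (r : seq I) (P Q : pred I) (F : I -> R) :
  \big[Rplus/0]_(i <- r | P i) (if Q i then F i else 0) =
  \big[Rplus/0]_(i <- r | P i && Q i) F i.
Proof. by rewrite big_mkcondr. Qed.

Lemma bigR_sub_pred {I : Type} (r : seq I) (P Q : pred I) (F : I -> R) :
  (forall i, P i -> Q i) -> (forall i, Q i -> 0 <= F i) ->
  \big[Rplus/0]_(i <- r | P i) F i <= \big[Rplus/0]_(i <- r | Q i) F i.
Proof.
move=> HPQ HF; rewrite [X in _ <= X](bigID P) /=.
rewrite (eq_bigl P) /=; last by move=> i; case HP: (P i); rewrite ?andbF // HPQ.
have := bigR_ge0 r (fun i => Q i && ~~ P i) F.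
by move=> /(_ (fun i H => HF i (proj1 (andP H)))); lra.
Qed.

Lemma bigR_const {I : finType} (A : {pred I}) (c : R) :
  \big[Rplus/0]_(i in A) c = INR #|A| * c.
Proof.
rewrite big_const; elim: #|_| => [|k IH]; first by rewrite /= Rmult_0_l.
by rewrite iterS IH S_INR; lra.
Qed.

Lemma bigR_constT {I : finType} (c : R) :
  \big[Rplus/0]_(i : I) c = INR #|{: I}| * c.
Proof. exact: (@bigR_const I {: I} c). Qed.

Lemma INR_card {I : finType} (P : pred I) :
  INR #|P| = \big[Rplus/0]_i (if P i then 1 else 0).
Proof. by rewrite -big_mkcond /= bigR_const Rmult_1_r. Qed.

(** * Escape from a set of states *)

Lemma law_prob {T : finType} (P : T -> T -> R) (t : nat) (x : T) :
  is_markov P ->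
  (forall y, 0 <= law P t x y) /\ \big[Rplus/0]_y law P t x y = 1.
Proof.
move=> [P0 P1]; elim: t => [|t [IH0 IH1]] /=.
  split=> [y|]; first by case: ifP => _; lra.
  by rewrite -big_mkcond /= big_pred1_eq.
split=> [y|].
  by rewrite rsumE; apply: bigR_ge0 => z _; apply: Rmult_le_pos.
under eq_bigr => y _ do rewrite rsumE.
rewrite exchange_big /= -[RHS]IH1; apply: eq_bigr => z _.
by rewrite -big_distrr /= -rsumE P1 Rmult_1_r.
Qed.

(** The differences [mu y - nu y] sum to zero, so an excess on [A] is matched by an equal deficit
    off [A], and half of the total absolute difference covers it. *)
Lemma tv_dist_ge {T : finType} (mu nu : T -> R) (A : {set T}) :
  \big[Rplus/0]_y mu y = 1 -> \big[Rplus/0]_y nu y = 1 ->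
  \big[Rplus/0]_(y in A) mu y - \big[Rplus/0]_(y in A) nu y <= tv_dist mu nu.
Proof.
move=> Hmu Hnu; rewrite /tv_dist rsumE.
have H0 : \big[Rplus/0]_y (mu y - nu y) = 0 by rewrite bigR_sub Hmu Hnu; lra.
rewrite -bigR_sub; move: H0; rewrite !(bigID (mem A) predT) /= => H0.
have H1 := bigR_le (index_enum T) (mem A) (fun y => mu y - nu y) (fun y => Rabs (mu y - nu y))
  (fun y _ => Rle_abs _).
have H2 : - (\big[Rplus/0]_(i | i \notin A) (mu i - nu i)) <=
  \big[Rplus/0]_(i | i \notin A) Rabs (mu i - nu i).
  rewrite -bigR_opp; apply: bigR_le => y _; rewrite -Rabs_Ropp; exact: Rle_abs.
simpl in *; lra.
Qed.

(* In one step the mass of [A] can only leave through [B], and the law started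
   from [pi] restricted to [A] stays below [pi]. *)
Lemma escape_mass {T : finType} (P : T -> T -> R) (pi : T -> R) (A B : {set T}) (t : nat) :
  is_markov P -> stationary P pi -> (forall x, 0 <= pi x) ->
  (forall x y, x \in A -> y \notin A -> 0 < P x y -> x \in B) ->
  \big[Rplus/0]_(x in A) pi x - INR t * \big[Rplus/0]_(x in A :&: B) pi x <=
  \big[Rplus/0]_(y in A) \big[Rplus/0]_(x in A) (pi x * law P t x y).
Proof.
move=> [P0 P1] Hst pi0 HB.
pose mu t y := \big[Rplus/0]_(x in A) (pi x * law P t x y).
have muS u y : mu u.+1 y = \big[Rplus/0]_z (mu u z * P z y).
  rewrite /mu /=.
  under eq_bigr => x _ do rewrite rsumE big_distrr /=.
  rewrite exchange_big /=; apply: eq_bigr => z _.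
  by rewrite big_distrl /=; apply: eq_bigr => x _; rewrite Rmult_assoc.
have mu_ge0 u y : 0 <= mu u y.
  apply: bigR_ge0 => x _; apply: Rmult_le_pos => //.
  by have [] := law_prob P u x (conj P0 P1).
have mu_le u y : mu u y <= pi y.
  elim: u y => [|u IH] y.
    rewrite /mu /= (eq_bigr (fun x => if x == y then pi x else 0)); last first.
      by move=> x _; rewrite eq_sym; case: ifP => _; lra.
    rewrite bigR_mask.
    apply: Rle_trans (bigR_sub_pred _ _ (pred1 y) _ _ _) _ => //=.
      by move=> i /andP[].
    by rewrite big_pred1_eq; lra.
  rewrite muS -[pi y]Hst rsumE; apply: bigR_le => z _.
  exact: Rmult_le_compat_r.
elim: t => [|t IH].
  rewrite [INR 0]/= Rmult_0_l Rminus_0_r exchange_big /=; apply: Req_le.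
  apply: eq_bigr => x xA; rewrite -big_distrr /= (bigD1 x) //= eqxx big1 ?Rplus_0_r ?Rmult_1_r //.
  by move=> y /andP[_ /negbTE->].
(* A state outside [B] keeps all its mass inside [A]. At a state of [B] the whole mass is given up,
   which costs at most [pi z] by [mu_le]. *)
have Hout z : z \in A -> mu t z - (if z \in B then pi z else 0) <=
    \big[Rplus/0]_(y in A) (mu t z * P z y).
  move=> zA; rewrite -big_distrr /=.
  have Hz : \big[Rplus/0]_(y in A) P z y + \big[Rplus/0]_(y | y \notin A) P z y = 1.
    by rewrite -(P1 z) rsumE [RHS](bigID (mem A)).
  case zB: (z \in B).
    have := mu_le t z; have := mu_ge0 t z.
    have : 0 <= \big[Rplus/0]_(y in A) P z y by apply: bigR_ge0.
    nra.
  have : \big[Rplus/0]_(y | y \notin A) P z y = 0.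
    apply: big1 => y yA; apply: Rle_antisym => //.
    apply: Rnot_lt_le => Hlt; by rewrite (HB z y) in zB.
  by have := mu_ge0 t z; nra.
have -> : \big[Rplus/0]_(y in A) mu t.+1 y =
    \big[Rplus/0]_z \big[Rplus/0]_(y in A) (mu t z * P z y).
  by rewrite [RHS]exchange_big /=; apply: eq_bigr => y _; exact: muS.
have H1 : \big[Rplus/0]_(z in A) \big[Rplus/0]_(y in A) (mu t z * P z y) <=
    \big[Rplus/0]_z \big[Rplus/0]_(y in A) (mu t z * P z y).
  by apply: bigR_sub_pred => // z _; apply: bigR_ge0 => y _; apply: Rmult_le_pos.
have H2 := bigR_le (index_enum T) (mem A) _ _ Hout.
move: H2; rewrite bigR_sub bigR_mask.
rewrite -[\big[Rplus/0]_(i | _ && _) _](eq_bigl _ _ (fun i => in_setI i A B)) => H2.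
rewrite S_INR.
change (\big[Rplus/0]_(x in A) pi x - INR t * \big[Rplus/0]_(x in A :&: B) pi x <=
  \big[Rplus/0]_(y in A) mu t y) in IH.
simpl in *; lra.
Qed.

(** Started from [pi] conditioned on [A], the chain is in [A] at time [t] with probability at least
    [1 - t * delta]. If it has mixed, that probability is at most [pi(A) + exp (-1)]. *)
Lemma bottleneck {T : finType} (P : T -> T -> R) (pi : T -> R) (A B : {set T})
    (t : nat) (delta : R) :
  is_markov P -> stationary P pi -> (forall x, 0 <= pi x) ->
  \big[Rplus/0]_x pi x = 1 ->
  (forall x y, x \in A -> y \notin A -> 0 < P x y -> x \in B) ->
  0 < \big[Rplus/0]_(x in A) pi x ->
  \big[Rplus/0]_(x in A :&: B) pi x <= delta * \big[Rplus/0]_(x in A) pi x ->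
  mixed_at P pi t ->
  1 - INR t * delta - exp (-1) <= \big[Rplus/0]_(x in A) pi x.
Proof.
move=> HP Hst pi0 pi1 HB HA Hdelta Hmix.
have := escape_mass P pi A B t HP Hst pi0 HB; rewrite exchange_big /= => Hesc.
set m := \big[Rplus/0]_(x in A) pi x in HA Hdelta Hesc *.
have : \big[Rplus/0]_(x in A) \big[Rplus/0]_(y in A) (pi x * law P t x y) <=
    \big[Rplus/0]_(x in A) (pi x * (m + exp (-1))).
  apply: bigR_le => x _; rewrite -big_distrr /=; apply: Rmult_le_compat_l => //.
  have [_ l1] := law_prob P t x HP.
  by have := tv_dist_ge (law P t x) pi A l1 pi1; have := Hmix x; rewrite -/m /=; lra.
rewrite -big_distrl /= -/m => H.
have Ht := pos_INR t.
have H3 : INR t * \big[Rplus/0]_(x in A :&: B) pi x <= INR t * (delta * m).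
  exact: Rmult_le_compat_l.
apply: (Rmult_le_reg_l m) => //; simpl in *; nra.
Qed.

(** * Product measures on the subsets of a finite type *)

(* Expectation of [F] when the coordinates listed in [l] are resampled
   independently with density [p], the others being read off [X]. *)
Fixpoint resample {T : finType} (p : R) (l : seq T) (F : {set T} -> R) (X : {set T}) : R :=
  match l with
  | [::] => F X
  | e :: l' => p * resample p l' F (e |: X) + (1 - p) * resample p l' F (X :\ e)
  end.

(** The base point [set0] is immaterial because every coordinate is resampled. *)
Definition expect {T : finType} (p : R) (F : {set T} -> R) : R :=
  resample p (enum T) F set0.

Lemma resample_ext {T : finType} p (l : seq T) (F G : {set T} -> R) X :
  (forall Y, F Y = G Y) -> resample p l F X = resample p l G X.
Proof. by move=> H; elim: l X => [|e l IH] X //=; rewrite !IH. Qed.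

Lemma resample_add {T : finType} p (l : seq T) (F G : {set T} -> R) X :
  resample p l (fun Y => F Y + G Y) X = resample p l F X + resample p l G X.
Proof. by elim: l X => [|e l IH] X //=; rewrite !IH; lra. Qed.

Lemma resample_scale {T : finType} p (l : seq T) (c : R) (F : {set T} -> R) X :
  resample p l (fun Y => c * F Y) X = c * resample p l F X.
Proof. by elim: l X => [|e l IH] X //=; rewrite !IH; lra. Qed.

Lemma resample_const {T : finType} p (l : seq T) (c : R) X :
  resample p l (fun=> c) X = c.
Proof. by elim: l X => [|e l IH] X //=; rewrite !IH; lra. Qed.

Lemma resample_sum {T : finType} {I : Type} p (l : seq T) (r : seq I) (P : pred I)
    (F : I -> {set T} -> R) X :
  resample p l (fun Y => \big[Rplus/0]_(i <- r | P i) F i Y) X =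
  \big[Rplus/0]_(i <- r | P i) resample p l (F i) X.
Proof.
elim: r => [|i r IH].
  by rewrite big_nil -[RHS](resample_const p l 0 X); apply: resample_ext => Y; rewrite big_nil.
rewrite big_cons -IH; case HP: (P i); last by apply: resample_ext => Y; rewrite big_cons HP.
by rewrite -resample_add; apply: resample_ext => Y; rewrite big_cons HP.
Qed.

Lemma resample_le {T : finType} p (l : seq T) (F G : {set T} -> R) X :
  0 <= p <= 1 -> (forall Y, F Y <= G Y) -> resample p l F X <= resample p l G X.
Proof.
by move=> Hp H; elim: l X => [|e l IH] X //=; have := IH (e |: X); have := IH (X :\ e); nra.
Qed.

Lemma resample_compl {T : finType} p (l : seq T) (F : {set T} -> R) X :
  resample (1 - p) l (fun Y => F (~: Y)) X = resample p l F (~: X).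
Proof.
elim: l X => [|e l IH] X //=; rewrite !IH.
have -> : ~: (e |: X) = ~: X :\ e by rewrite setCU setIC setDE.
have -> : ~: (X :\ e) = e |: ~: X by rewrite setDE setCI setCK setUC.
lra.
Qed.

Lemma resample_agree {T : finType} p (l : seq T) (F : {set T} -> R) (X Y : {set T}) :
  (forall e, e \notin l -> (e \in X) = (e \in Y)) -> resample p l F X = resample p l F Y.
Proof.
elim: l X Y => [|e l IH] X Y H /=; first by congr F; apply/setP => e; exact: H.
by congr (_ * _ + _ * _); apply: IH => f Hf; rewrite !inE; case: (eqVneq f e) => //= Hfe;
  rewrite H // inE negb_or Hfe.
Qed.

Lemma expect_compl {T : finType} p (F : {set T} -> R) :
  expect (1 - p) (fun Y => F (~: Y)) = expect p F.
Proof. by rewrite /expect resample_compl; apply: resample_agree => e; rewrite mem_enum. Qed.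

Definition set_increasing {T : finType} (F : {set T} -> R) :=
  forall X Y : {set T}, X \subset Y -> F X <= F Y.
Definition set_decreasing {T : finType} (F : {set T} -> R) :=
  forall X Y : {set T}, X \subset Y -> F Y <= F X.

Lemma resample_increasing {T : finType} p (l : seq T) (F : {set T} -> R) :
  0 <= p <= 1 -> set_increasing F -> set_increasing (resample p l F).
Proof.
move=> Hp HF; elim: l => [|e l IH] X Y HXY //=; first exact: HF.
have := IH _ _ (setUS [set e] HXY); have := IH _ _ (setSD [set e] HXY); nra.
Qed.

Lemma decreasing_opp {T : finType} (F : {set T} -> R) :
  set_decreasing F -> set_increasing (fun X => -1 * F X).
Proof. by move=> H X Y /H; lra. Qed.

(** Induction on the coordinates: after conditioning on [e], what remains is Chebyshev's inequality
    on two points, where the covariance is [- p * (1 - p) * ((a - b) * (d - c))]. *)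
Lemma harris {T : finType} p (l : seq T) (F G : {set T} -> R) X :
  0 <= p <= 1 -> set_decreasing F -> set_increasing G ->
  resample p l (fun Y => F Y * G Y) X <= resample p l F X * resample p l G X.
Proof.
move=> Hp HF HG; elim: l X => [|e l IH] X /=; first lra.
have Hsub : X :\ e \subset e |: X by apply: subset_trans (subD1set _ _) (subsetUr _ _).
have := resample_increasing p l _ Hp HG _ _ Hsub.
have := resample_increasing p l _ Hp (decreasing_opp _ HF) _ _ Hsub.
rewrite !resample_scale.
have := IH (e |: X); have := IH (X :\ e).
set a := resample _ _ F _; set b := resample _ _ F _.
set c := resample _ _ G _; set d := resample _ _ G _ => H1 H2 H3 H4.
have H5 : 0 <= (a - b) * (d - c) by apply: Rmult_le_pos; lra.
have H6 : 0 <= p * (1 - p) * ((a - b) * (d - c)) by apply: Rmult_le_pos; nra.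
have H7 := Rmult_le_compat_l p _ _ (proj1 Hp) H2.
have H8 : (1 - p) * resample p l (fun Y => F Y * G Y) (X :\ e) <= (1 - p) * (a * c).
  by apply: Rmult_le_compat_l => //; lra.
nra.
Qed.

Definition lipschitz_at {T : finType} (F : {set T} -> R) (f : T) (c : R) :=
  forall X Y : {set T}, X :\ f = Y :\ f -> Rabs (F X - F Y) <= c.

Lemma resample_lipschitz {T : finType} p (l : seq T) (F : {set T} -> R) f c :
  0 <= p <= 1 -> lipschitz_at F f c -> lipschitz_at (resample p l F) f c.
Proof.
move=> Hp HF; elim: l => [|e l IH] X Y HXY /=; first exact: HF.
have H1 : Rabs (resample p l F (e |: X) - resample p l F (e |: Y)) <= c.
  by apply: IH; rewrite !setDUl HXY.
have H2 : Rabs (resample p l F (X :\ e) - resample p l F (Y :\ e)) <= c.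
  have comm Z : Z :\ e :\ f = Z :\ f :\ e by apply/setP => x; rewrite !inE andbCA.
  by apply: IH; rewrite !comm HXY.
by split_Rabs; nra.
Qed.

(** Squaring [1 - x / 2 <= exp (- (x / 2))] gives [exp x * (1 - x / 2) ^ 2 <= 1], while
    [(1 + x + x ^ 2) * (1 - x / 2) ^ 2] exceeds [1] by [x ^ 2 * (1 - 3 * x + x ^ 2) / 4]. *)
Lemma exp_le_quadratic (x : R) : Rabs x <= / 4 -> exp x <= 1 + x + x ^ 2.
Proof.
move=> Hx.
have H := exp_ineq1_le (- (x / 2)).
have H1 : exp x * (exp (- (x / 2)) * exp (- (x / 2))) = 1.
  by rewrite -!exp_plus -exp_0; congr exp; lra.
have H2 := exp_pos x.
have Hx' : - / 4 <= x <= / 4 by split_Rabs; lra.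
have H3 : exp x * ((1 - x / 2) * (1 - x / 2)) <= 1.
  apply: Rle_trans (Req_le _ _ H1); apply: Rmult_le_compat_l; first lra.
  by apply: Rmult_le_compat; lra.
have H4 : 1 <= (1 + x + x ^ 2) * ((1 - x / 2) * (1 - x / 2)).
  have : 0 <= x ^ 2 * (1 - 3 * x + x ^ 2) by apply: Rmult_le_pos; nra.
  by nra.
apply: (Rmult_le_reg_r ((1 - x / 2) * (1 - x / 2))); first by apply: Rmult_lt_0_compat; lra.
lra.
Qed.

(** Bounded differences inequality in exponential moment form, proved one coordinate at a time. The
    condition [theta * c f <= / 4] keeps each increment in the range where [exp] has the quadratic
    bound; the constant is not sharp. *)
Lemma resample_mcdiarmid {T : finType} p (l : seq T) (F : {set T} -> R) (c : T -> R) theta X :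
  0 <= p <= 1 -> (forall f, lipschitz_at F f (c f)) ->
  (forall f, 0 <= c f) -> 0 <= theta -> (forall f, theta * c f <= / 4) ->
  resample p l (fun Y => exp (theta * F Y)) X <=
  exp (theta * resample p l F X + theta ^ 2 * \big[Rplus/0]_(f <- l) (c f ^ 2)).
Proof.
move=> Hp HF c0 t0 Hc; elim: l X => [|e l IH] X /=.
  by rewrite big_nil Rmult_0_r Rplus_0_r; apply: Rle_refl.
rewrite big_cons.
have := resample_lipschitz p l F e _ Hp (HF e) (e |: X) (X :\ e).
have -> : (e |: X) :\ e = X :\ e :\ e.
  by apply/setP => x; rewrite !inE; case: eqP.
move=> /(_ erefl).
have := IH (e |: X); have := IH (X :\ e).
set S := \big[Rplus/0]_(_ <- _) _.
set a := resample p l F _; set b := resample p l F _ => H1 H2 Hab.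
set m := p * b + (1 - p) * a.
have key x : Rabs x <= theta * c e -> exp (theta * m + x) <= exp (theta * m) * (1 + x + x ^ 2).
  move=> Hx; rewrite exp_plus; apply: Rmult_le_compat_l; first exact: Rlt_le (exp_pos _).
  by apply: exp_le_quadratic; have := Hc e; lra.
have Hab' : - (theta * c e) <= theta * (b - a) <= theta * c e.
  by split; split_Rabs; nra.
have Kb := key (theta * (1 - p) * (b - a)); have Ka := key (- (theta * p * (b - a))).
have {}Kb := Kb ltac:(split_Rabs; nra); have {}Ka := Ka ltac:(split_Rabs; nra).
(* The deviations of the two branches from [theta * m] have mean zero, so the linear terms cancel
   and only the variance [p * (1 - p) * x ^ 2] is left. *)
have Hm : p * exp (theta * b) + (1 - p) * exp (theta * a) <=
    exp (theta * m) * (1 + theta ^ 2 * c e ^ 2).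
  have -> : theta * b = theta * m + theta * (1 - p) * (b - a) by rewrite /m; lra.
  have -> : theta * a = theta * m + - (theta * p * (b - a)) by rewrite /m; lra.
  have Hpos := exp_pos (theta * m).
  set x := theta * (b - a) in Hab'.
  have Hx2 : x ^ 2 <= theta ^ 2 * c e ^ 2 by nra.
  apply: Rle_trans (_ : exp (theta * m) * (1 + x ^ 2) <= _); last first.
    by apply: Rmult_le_compat_l; lra.
  apply: Rle_trans (_ : exp (theta * m) * (1 + p * (1 - p) * x ^ 2) <= _); last first.
    by apply: Rmult_le_compat_l; nra.
  have := Rmult_le_compat_l _ _ _ (proj1 Hp) Kb.
  have Hp1 : 0 <= 1 - p by lra.
  have := Rmult_le_compat_l _ _ _ Hp1 Ka.
  by rewrite /x; nra.
have HS : exp (theta * m) * (1 + theta ^ 2 * c e ^ 2) <= exp (theta * m + theta ^ 2 * c e ^ 2).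
  rewrite exp_plus; apply: Rmult_le_compat_l; first exact: Rlt_le (exp_pos _).
  exact: exp_ineq1_le.
rewrite !exp_plus in H1 H2.
have E0 := exp_pos (theta ^ 2 * S).
apply: Rle_trans (_ : (p * exp (theta * b) + (1 - p) * exp (theta * a)) * exp (theta ^ 2 * S) <= _).
  by have := Rmult_le_compat_l _ _ _ (proj1 Hp) H2; nra.
have -> : theta * m + theta ^ 2 * (c e ^ 2 + S) =
    (theta * m + theta ^ 2 * c e ^ 2) + theta ^ 2 * S by lra.
rewrite (exp_plus (_ + _)); apply: Rmult_le_compat_r; lra.
Qed.

(** The weight [lam ^ #|X|] makes the points independent with odds [lam], and [(1 + lam) ^ #|T|] is
    its total mass. *)
Lemma sum_resample {T : finType} (lam : R) (F : {set T} -> R) :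
  0 < lam ->
  \big[Rplus/0]_(X : {set T}) (lam ^ #|X| * F X) =
  (1 + lam) ^ #|T| * expect (lam / (1 + lam)) F.
Proof.
move=> Hl.
(* The induction runs over sums restricted to those [Y] that coincide with [X] outside [l]; a new
   coordinate splits such a sum according to whether it lies in [Y]. *)
suff H (l : seq T) (X : {set T}) : uniq l -> (forall e, e \in l -> e \notin X) ->
   \big[Rplus/0]_(Y : {set T} | Y :\: [set x in l] == X) (lam ^ #|Y| * F Y) =
   lam ^ #|X| * (1 + lam) ^ size l * resample (lam / (1 + lam)) l F X.
  have := H (enum T) set0 (enum_uniq _); rewrite cards0 -cardE Rmult_1_l => <-; last first.
    by move=> e; rewrite inE.
  apply: eq_bigl => Y; apply/esym/eqP/setP => x; rewrite !inE mem_enum //.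
elim: l X => [|e l IH] X /=.
  move=> _ _; rewrite (big_pred1 X) ?Rmult_1_r // => Y.
  by congr (_ == _); apply/setP => x; rewrite !inE.
move=> /andP[el ul] HX.
have eX : e \notin X by apply: HX; rewrite inE eqxx.
have -> : X :\ e = X by apply/setDidPl; rewrite disjoint_sym disjoints1.
have H1 := IH (e |: X) ul; have H2 := IH X ul.
rewrite (bigID (fun Y : {set T} => e \in Y)) /=.
rewrite (eq_bigl (fun Y : {set T} => Y :\: [set x in l] == e |: X)); last first.
  move=> Y; apply/andP/eqP => [[/eqP HY eY]|HY].
    apply/setP => x; move/setP/(_ x): HY; rewrite !inE.
    by case: (eqVneq x e) => [->|] //=; rewrite el eY.
  have eY : e \in Y by move/setP/(_ e): HY; rewrite !inE eqxx /= => /andP[].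
  split=> //; apply/eqP/setP => x; move/setP/(_ x): HY; rewrite !inE.
  by case: (eqVneq x e) => [->|] //=; rewrite (negbTE eX).
rewrite H1; last first.
  move=> f fl; rewrite !inE negb_or HX ?inE ?fl ?orbT // andbT.
  by apply: contraNneq el => <-.
rewrite (eq_bigl (fun Y : {set T} => Y :\: [set x in l] == X)); last first.
  move=> Y; apply/andP/eqP => [[/eqP HY eY]|HY].
    apply/setP => x; move/setP/(_ x): HY; rewrite !inE.
    by case: (eqVneq x e) => [->|] //=; rewrite (negbTE eY) (negbTE eX) andbF.
  have eY : e \notin Y by move/setP/(_ e): HY; rewrite !inE (negbTE eX) el /= => ->.
  split=> //; apply/eqP/setP => x; move/setP/(_ x): HY; rewrite !inE.
  by case: (eqVneq x e) => [->|] //=; rewrite (negbTE eX).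
rewrite H2; last by move=> f fl; apply: HX; rewrite inE fl orbT.
rewrite cardsU1 eX add1n /=; field; lra.
Qed.

(** * Conditioning a Gibbs weight on a bound for its gradient *)

Lemma exp_le_mono (x y : R) : x <= y -> exp x <= exp y.
Proof. by case=> [H|->]; [apply: Rlt_le; apply: exp_increasing | apply: Rle_refl]. Qed.

Definition Rleb (x y : R) : bool := if Rle_dec x y then true else false.

Lemma RlebP (x y : R) : reflect (x <= y) (Rleb x y).
Proof. by rewrite /Rleb; case: Rle_dec => H; constructor. Qed.

Lemma decreasing_step {T : finType} (F : {set T} -> R) :
  (forall (X : {set T}) e, e \notin X -> F (e |: X) <= F X) -> set_decreasing F.
Proof.
move=> H X Y; have [k] := ubnP #|Y :\: X|; elim: k X Y => // k IH X Y Hk HXY.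
have [/eqP HY|[e He]] := set_0Vmem (Y :\: X).
  have -> : Y = X by apply/eqP; rewrite eqEsubset HXY -setD_eq0 HY.
  exact: Rle_refl.
have [eX eY] : e \notin X /\ e \in Y by move: He; rewrite inE => /andP.
apply: Rle_trans (H X e eX); apply: IH; last by rewrite subUset sub1set eY.
move: Hk; rewrite (cardsD1 e) He ltnS add1n => Hk; apply: leq_trans Hk.
by rewrite setDDl setUC.
Qed.

(** Used with [W] the Gibbs weight cut off outside a sublevel set: it lets increasing events be
    estimated under independent points. *)
Lemma harris_domination {T : finType} (lam : R) (W G : {set T} -> R) :
  0 < lam -> (forall (X : {set T}) e, e \notin X -> W (e |: X) <= lam * W X) -> set_increasing G ->
  \big[Rplus/0]_(X : {set T}) (W X * G X) <=
  \big[Rplus/0]_(X : {set T}) W X * expect (lam / (1 + lam)) G.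
Proof.
move=> Hl HW HG.
have Hpow k : 0 < lam ^ k by apply: pow_lt.
(* [W] is a decreasing density against the product weight [lam ^ #|X|], so Harris'
   inequality compares it with the product measure. *)
pose F (X : {set T}) := W X / lam ^ #|X|.
have HF : set_decreasing F.
  apply: decreasing_step => X e eX; rewrite /F cardsU1 eX add1n /=.
  apply: (Rmult_le_reg_r (lam * lam ^ #|X|)); first by apply: Rmult_lt_0_compat.
  have := HW X e eX; have := Hpow #|X| => H1 H2.
  have -> : W (e |: X) / (lam * lam ^ #|X|) * (lam * lam ^ #|X|) = W (e |: X) by field; lra.
  by have -> : W X / lam ^ #|X| * (lam * lam ^ #|X|) = lam * W X by field; lra.
have WE X : W X = lam ^ #|X| * F X by rewrite /F; field; have := Hpow #|X|; lra.
rewrite (eq_bigr (fun X : {set T} => lam ^ #|X| * (F X * G X))); last first.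
  by move=> X _; rewrite WE; lra.
rewrite (eq_bigr (fun X : {set T} => lam ^ #|X| * F X) (F1 := W)); last by move=> X _; exact: WE.
rewrite !sum_resample // Rmult_assoc; apply: Rmult_le_compat_l; first by apply: pow_le; lra.
apply: harris => //.
by split; [apply: Rle_mult_inv_pos | apply: (Rmult_le_reg_r (1 + lam)); last field_simplify]; lra.
Qed.

Definition gradient {T : finType} (H : {set T} -> R) (e : T) (X : {set T}) : R :=
  H (e |: X) - H (X :\ e).

(** Monotone gradients make sublevel sets closed under removing points. The coefficient [c e f] is
    the influence of [f] on the gradient at [e]; the bound [kap] on each and [C] on their sum give a
    sum of squares at most [kap * C], as concentration requires. For the Hamiltonian, [kap] is
    [C / n]. *)
Record tame {T : finType} (H : {set T} -> R) (kap C : R) : Prop := Tame {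
  tame_increasing : forall e, set_increasing (gradient H e);
  tame_lipschitz : exists c : T -> T -> R,
    [/\ forall e f, 0 <= c e f <= kap,
        forall e, \big[Rplus/0]_f c e f <= C &
        forall e f, lipschitz_at (gradient H e) f (c e f)] }.

Definition sublevel {T : finType} (H : {set T} -> R) (h : R) : {set {set T}} :=
  [set X | [forall e, Rleb (gradient H e X) h]].
Definition superlevel {T : finType} (H : {set T} -> R) (h : R) : {set {set T}} :=
  [set X | [forall e, Rleb h (gradient H e X)]].
Definition boundary {T : finType} (A : {set {set T}}) (k : nat) : {set {set T}} :=
  [set X | [exists Y : {set T}, (Y \notin A) && (#|(X :\: Y) :|: (Y :\: X)| <= k)%N]].

Lemma lipschitz_card {T : finType} (F : {set T} -> R) (kap : R) (X Y : {set T}) k :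
  (forall f, lipschitz_at F f kap) -> 0 <= kap ->
  (#|(X :\: Y) :|: (Y :\: X)| <= k)%N -> Rabs (F X - F Y) <= INR k * kap.
Proof.
move=> HF k0; elim: k X => [|k IH] X.
  rewrite leqn0 cards_eq0 setU_eq0 !setD_eq0 => /andP[H1 H2].
  have -> : X = Y by apply/eqP; rewrite eqEsubset H1.
  by rewrite Rminus_diag Rabs_R0 /=; lra.
move=> Hk; rewrite S_INR.
have [/eqP HD|[f Hf]] := set_0Vmem ((X :\: Y) :|: (Y :\: X)).
  have : Rabs (F X - F Y) <= INR k * kap by apply: IH; rewrite -cards_eq0 in HD; rewrite (eqP HD).
  by lra.
pose X' := if f \in X then X :\ f else f |: X.
have H1 : Rabs (F X - F X') <= kap.
  by apply: (HF f); rewrite /X'; case: ifP => _; apply/setP => x; rewrite !inE; case: (x == f).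
have H2 : Rabs (F X' - F Y) <= INR k * kap.
  apply: IH; rewrite -ltnS; apply: leq_trans Hk.
  rewrite [X in (_ < X)%N](cardsD1 f) Hf add1n ltnS; apply: subset_leq_card.
  have XE x : (x \in X') = if x == f then f \notin X else x \in X.
    by rewrite /X'; case: ifP => _; rewrite !inE; case: (x == f).
  apply/subsetP => x; move: Hf; rewrite !inE XE.
  by case: eqP => [->|_]; case: (f \in X); case: (f \in Y).
by split_Rabs; lra.
Qed.

(** The slack [2 * delta] is spent in two halves: [k] changes move a gradient by at most [delta], so
    a boundary point has some gradient above [h - delta], and this is still [delta] above the mean.
    The factor [#|T|] is the union bound over [e]; [theta] is left free for later optimisation. *)
Lemma sublevel_boundary {T : finType} (H : {set T} -> R) (q kap C delta theta : R) (k : nat) :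
  let h := ln (q / (1 - q)) in
  0 < q < 1 -> tame H kap C -> 0 <= kap -> 0 <= delta -> 0 <= theta ->
  (forall e, expect q (gradient H e) <= h - 2 * delta) ->
  theta * kap <= / 4 -> INR k * kap <= delta ->
  set0 \in sublevel H h /\
  \big[Rplus/0]_(X in sublevel H h :&: boundary (sublevel H h) k) exp (H X) <=
  INR #|{: T}| * exp (- (theta * delta) + theta ^ 2 * (kap * C)) *
    \big[Rplus/0]_(X in sublevel H h) exp (H X).
Proof.
move=> h Hq [Hinc [c [c0 cC cL]]] kap0 d0 t0 Hmean Htk Hk.
have Hq' : 0 <= q <= 1 by lra.
have kL e f : lipschitz_at (gradient H e) f kap.
  by move=> X Y /cL HXY; have := HXY e; have := c0 e f; lra.
set A := sublevel H h.
have inA X : reflect (forall e, gradient H e X <= h) (X \in A).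
  by rewrite inE; apply: (iffP forallP) => HX e; apply/RlebP; exact: HX.
split.
  (* An increasing function takes at [set0] a value no larger than its mean. *)
  apply/inA => e.
  have : expect q (fun _ : {set T} => gradient H e set0) <= expect q (gradient H e).
    by rewrite /expect; apply: resample_le => // Y; apply: Hinc; exact: sub0set.
  rewrite /expect resample_const; have := Hmean e; rewrite /expect; lra.
pose lam := q / (1 - q).
have lam0 : 0 < lam by apply: Rdiv_lt_0_compat; lra.
have lamq : lam / (1 + lam) = q by rewrite /lam; field; lra.
have lamh : exp h = lam by rewrite exp_ln.
pose W X := if X \in A then exp (H X) else 0.
have W0 X : 0 <= W X by rewrite /W; case: ifP => _; [apply: Rlt_le; exact: exp_pos | lra].
(* If [e |: X] lies in [A], so does [X] by monotonicity of the gradients, and the ratio of the two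
   weights is the exponential of the gradient at [e], at most [exp h]. *)
have Wstep (X : {set T}) e : e \notin X -> W (e |: X) <= lam * W X.
  move=> eX; rewrite {1}/W; case: ifP => [/inA HX|_]; last by have := W0 X; nra.
  have XA : X \in A.
    by apply/inA => f; apply: Rle_trans (HX f); apply: Hinc; exact: subsetUr.
  rewrite /W XA -lamh -exp_plus.
  have := elimT (inA X) XA e; rewrite /gradient.
  have -> : X :\ e = X by apply/setDidPl; rewrite disjoint_sym disjoints1.
  by move=> Hle; apply: exp_le_mono; lra.
(* A boundary point has some gradient above [h - delta], an increasing event whose
   probability under the product measure is bounded by Chernoff's method. *)
pose g e X := if Rleb (h - delta) (gradient H e X) then 1 else 0.
have g0 e X : 0 <= g e X by rewrite /g; case: ifP; lra.
have ginc e : set_increasing (g e).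
  move=> X Y HXY; rewrite /g; case: RlebP => H1; case: RlebP => H2; try lra.
  by have := Hinc e X Y HXY; lra.
have gE e : expect q (g e) <= exp (- (theta * delta) + theta ^ 2 * (kap * C)).
  apply: Rle_trans (_ : expect q
    (fun X => exp (- (theta * (h - delta))) * exp (theta * gradient H e X)) <= _).
    rewrite /expect; apply: resample_le => // X; rewrite -exp_plus /g; case: RlebP => Hg.
      by rewrite -exp_0; apply: exp_le_mono; nra.
    exact: Rlt_le (exp_pos _).
  rewrite /expect resample_scale.
  have := resample_mcdiarmid q (enum T) (gradient H e) (c e) theta set0 Hq' (cL e).
  move=> /(_ (fun f => proj1 (c0 e f)) t0) Hmc.
  have {}Hmc := Hmc (fun f => Rle_trans _ _ _ (Rmult_le_compat_l _ _ _ t0 (proj2 (c0 e f))) Htk).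
  apply: Rle_trans (Rmult_le_compat_l _ _ _ (Rlt_le _ _ (exp_pos _)) Hmc) _.
  rewrite -exp_plus.
  have Hc2 : \big[Rplus/0]_(f <- enum T) (c e f ^ 2) <= kap * C.
    apply: Rle_trans (_ : \big[Rplus/0]_(f <- enum T) (kap * c e f) <= _).
      by apply: bigR_le => f _; have := c0 e f; nra.
    rewrite -big_distrr big_enum /=; apply: Rmult_le_compat_l => //; exact: cC.
  apply: exp_le_mono; have := Hmean e; rewrite /expect => Hm.
  have := Rmult_le_compat_l _ _ _ t0 Hm.
  have := Rmult_le_compat_l (theta ^ 2) _ _ (pow_le _ 2 t0) Hc2.
  lra.
apply: Rle_trans (_ : \big[Rplus/0]_(X : {set T}) \big[Rplus/0]_e (W X * g e X) <= _).
  rewrite [X in X <= _]big_mkcond; apply: bigR_le => X _; case: ifP => HX; last first.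
    by apply: bigR_ge0 => e _; apply: Rmult_le_pos.
  move: HX; rewrite inE => /andP[XA]; rewrite inE => /existsP[Y /andP[YA HXY]].
  move: YA; rewrite inE => /forallPn[e /RlebP He].
  rewrite (bigD1 e) //= {1}/W XA.
  have -> : g e X = 1.
    rewrite /g; case: RlebP => // Hn.
    have := lipschitz_card _ _ X Y k (kL e) kap0 HXY; split_Rabs; lra.
  have : 0 <= \big[Rplus/0]_(i | i != e) (W X * g i X).
    by apply: bigR_ge0 => f _; apply: Rmult_le_pos.
  simpl in *; lra.
rewrite exchange_big /=.
have -> : \big[Rplus/0]_(X in A) exp (H X) = \big[Rplus/0]_(X : {set T}) W X by rewrite big_mkcond.
set S := \big[Rplus/0]_(X : {set T}) W X.
apply: Rle_trans (_ : \big[Rplus/0]_(e : T)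
   (S * exp (- (theta * delta) + theta ^ 2 * (kap * C))) <= _).
  apply: bigR_le => e _; have := harris_domination lam W (g e) lam0 Wstep (ginc e).
  rewrite lamq => HH; apply: Rle_trans HH _; apply: Rmult_le_compat_l => //.
  by apply: bigR_ge0.
by rewrite bigR_constT; apply: Req_le; set N := INR _; set E := exp _; ring.
Qed.

(** Complementation reduces this to [sublevel_boundary]: [H (~: X)] has the negated gradients, is
    again tame, and the density [1 - q] has log-odds [- h]. *)
Lemma superlevel_boundary {T : finType} (H : {set T} -> R) (q kap C delta theta : R) (k : nat) :
  let h := ln (q / (1 - q)) in
  0 < q < 1 -> tame H kap C -> 0 <= kap -> 0 <= delta -> 0 <= theta ->
  (forall e, h + 2 * delta <= expect q (gradient H e)) ->
  theta * kap <= / 4 -> INR k * kap <= delta ->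
  setT \in superlevel H h /\
  \big[Rplus/0]_(X in superlevel H h :&: boundary (superlevel H h) k) exp (H X) <=
  INR #|{: T}| * exp (- (theta * delta) + theta ^ 2 * (kap * C)) *
    \big[Rplus/0]_(X in superlevel H h) exp (H X).
Proof.
move=> h Hq [Hinc [c [c0 cC cL]]] kap0 d0 t0 Hmean Htk Hk.
pose H' X := H (~: X).
have gE e X : gradient H' e X = -1 * gradient H e (~: X).
  rewrite /gradient /H'.
  have -> : ~: (e |: X) = ~: X :\ e by rewrite setCU setIC setDE.
  have -> : ~: (X :\ e) = e |: ~: X by rewrite setDE setCI setCK setUC.
  lra.
have hE : ln ((1 - q) / (1 - (1 - q))) = - h.
  rewrite /h; have -> : (1 - q) / (1 - (1 - q)) = / (q / (1 - q)) by field; lra.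
  by rewrite ln_Rinv //; apply: Rdiv_lt_0_compat; lra.
have tame' : tame H' kap C.
  split.
    move=> e X Y HXY; rewrite !gE; have := Hinc e (~: Y) (~: X).
    by rewrite setCS => /(_ HXY); lra.
  exists c; split=> // e f X Y HXY; rewrite !gE.
  have := cL e f (~: X) (~: Y).
  have comp Z : ~: Z :\ f = ~: (Z :\ f) :\ f.
    by apply/setP => x; rewrite !inE; case: eqP.
  by rewrite comp HXY -comp => /(_ erefl); split_Rabs; lra.
have Hmean' e : expect (1 - q) (gradient H' e) <= ln ((1 - q) / (1 - (1 - q))) - 2 * delta.
  have -> : expect (1 - q) (gradient H' e) = -1 * expect q (gradient H e).
    rewrite -(expect_compl q) /expect -resample_scale; apply: resample_ext => X; exact: gE.
  by rewrite hE; have := Hmean e; lra.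
have Hq' : 0 < 1 - q < 1 by lra.
have := sublevel_boundary H' (1 - q) kap C delta theta k Hq' tame' kap0 d0 t0 Hmean' Htk Hk.
rewrite hE.
have memE X : (~: X \in sublevel H' (- h)) = (X \in superlevel H h).
  rewrite !inE; apply: eq_forallb => e; rewrite gE setCK.
  by apply/RlebP/RlebP; lra.
have bdE X : (~: X \in boundary (sublevel H' (- h)) k) = (X \in boundary (superlevel H h) k).
  rewrite !inE; apply/existsP/existsP => -[Y HY]; exists (~: Y); move: HY.
    rewrite -{1}[Y]setCK memE; congr (_ && (_ <= _)%N).
    by apply: eq_card => x; rewrite !inE; do 2 case: (_ \in _).
  rewrite memE; congr (_ && (_ <= _)%N).
  by apply: eq_card => x; rewrite !inE; do 2 case: (_ \in _).
case=> H0 Hsum; split; first by rewrite -memE setCT.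
have reE (A' A : {set {set T}}) : (forall X, (~: X \in A') = (X \in A)) ->
    \big[Rplus/0]_(X in A') exp (H' X) = \big[Rplus/0]_(X in A) exp (H X).
  move=> HA; rewrite (reindex_inj (inv_inj (@setCK T))) /=.
  by rewrite (eq_bigl _ _ HA); apply: eq_bigr => X _; rewrite /H' setCK.
move: Hsum; rewrite (reE _ _ memE) (reE _ (superlevel H h :&: boundary (superlevel H h) k)) //.
by move=> X; rewrite !in_setI memE bdE.
Qed.

(** * Copies of a set system *)

Lemma resample_subset {T : finType} q (l : seq T) (S X : {set T}) :
  uniq l ->
  resample q l (fun Y : {set T} => if S \subset Y then 1 else 0) X =
  if S :\: [set x in l] \subset X then q ^ #|S :&: [set x in l]| else 0.
Proof.
elim: l X => [|e l IH] X /=.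
  move=> _; have -> : [set x in [::]] = set0 :> {set T} by apply/setP => x; rewrite !inE.
  by rewrite setD0 setI0 cards0.
move=> /andP[el ul]; rewrite !IH //.
have -> : [set x in e :: l] = e |: [set x in l] by apply/setP => x; rewrite !inE.
rewrite -setDDl.
case eS: (e \in S).
  have -> : (S :\: [set x in l] \subset X :\ e) = false.
    by apply/negP => /subsetP/(_ e); rewrite !inE eS el eqxx => /(_ isT).
  have -> : (S :\: [set x in l] \subset e |: X) = (S :\ e :\: [set x in l] \subset X).
    apply/subsetP/subsetP => H x; move/(_ x): H; rewrite !inE.
      by case: eqP => //= _; rewrite ?andbF.
    by case: eqP => //= _; rewrite ?andbF.
  have -> : S :&: (e |: [set x in l]) = e |: (S :&: [set x in l]).
    by apply/setP => x; rewrite !inE; case: eqP => [->|]; rewrite ?eS.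
  rewrite cardsU1 !inE (negbTE el) andbF add1n Rmult_0_r Rplus_0_r.
  by case: ifP => _ /=; lra.
have SE : S :\ e = S by apply/setDidPl; rewrite disjoint_sym disjoints1 eS.
have -> : S :&: (e |: [set x in l]) = S :&: [set x in l].
  by apply/setP => x; rewrite !inE; case: eqP => [->|]; rewrite ?eS.
have -> : (S :\: [set x in l] \subset e |: X) = (S :\: [set x in l] \subset X).
  apply/subsetP/subsetP => H x; move/(_ x): H; rewrite !inE.
    by case: eqP => [->|] //=; rewrite eS andbF => _.
  by case: eqP => //= _; rewrite ?andbF.
have -> : (S :\: [set x in l] \subset X :\ e) = (S :\: [set x in l] \subset X).
  apply/subsetP/subsetP => H x; move/(_ x): H; rewrite !inE.
    by case: eqP => [->|] //=; rewrite eS andbF => _.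
  by case: eqP => [->|] //=; rewrite eS andbF => _.
by rewrite SE; lra.
Qed.

Lemma expect_subset {T : finType} q (S : {set T}) :
  expect q (fun Y : {set T} => if S \subset Y then 1 else 0) = q ^ #|S|.
Proof.
rewrite /expect resample_subset ?enum_uniq //.
have -> : [set x in enum T] = [set: T] by apply/setP => x; rewrite !inE mem_enum.
by rewrite setIT setDT sub0set.
Qed.

(** Abstract form of [hom_count]: the indices will be injective vertex maps, and [S i] the set of
    pairs onto which [i] sends the edges. *)
Definition copies {T I : finType} (A : {set I}) (S : I -> {set T}) (X : {set T}) : nat :=
  #|[set i in A | S i \subset X]|.

Definition copies_at {T I : finType} (A : {set I}) (S : I -> {set T}) (e : T) : {set I} :=
  [set i in A | e \in S i].

(** Copies avoiding [e] cancel, and a copy through [e] is never contained in [X :\ e]. *)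
Lemma gradient_copies {T I : finType} (A : {set I}) (S : I -> {set T}) e X :
  gradient (fun Y => INR (copies A S Y)) e X =
  \big[Rplus/0]_(i in copies_at A S e) (if S i :\ e \subset X then 1 else 0).
Proof.
have E Y : INR (copies A S Y) = \big[Rplus/0]_(i in A) (if S i \subset Y then 1 else 0).
  by rewrite bigR_mask /copies -(Rmult_1_r (INR _)) -bigR_const; apply: eq_bigl => i; rewrite inE.
rewrite /gradient !E -bigR_sub.
rewrite (eq_bigr (fun i => if e \in S i then (if S i :\ e \subset X then 1 else 0) else 0)).
  by rewrite bigR_mask; apply: eq_bigl => i; rewrite inE.
move=> i _; case eS: (e \in S i).
  have -> : (S i \subset X :\ e) = false.
    by apply/negP => /subsetP/(_ e eS); rewrite !inE eqxx.
  by rewrite subDset Rminus_0_r.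
rewrite subsetD1 eS andbT.
have -> : (S i \subset e |: X) = (S i \subset X); last lra.
rewrite -subDset; have -> // : S i :\ e = S i.
by apply/setDidPl; rewrite disjoint_sym disjoints1 eS.
Qed.

(** Only copies through both [e] and [f] can notice a change at [f]. *)
Lemma gradient_copies_lipschitz {T I : finType} (A : {set I}) (S : I -> {set T}) e f :
  lipschitz_at (gradient (fun Y => INR (copies A S Y)) e) f
    (INR #|[set i in copies_at A S e | f \in S i :\ e]|).
Proof.
move=> X Y HXY; rewrite !gradient_copies -bigR_sub.
apply: Rle_trans (bigR_abs _ _ _) _.
rewrite -(Rmult_1_r (INR _)) -bigR_const.
rewrite [X in _ <= X](eq_bigl (fun i => (i \in copies_at A S e) && (f \in S i :\ e))); last first.
  by move=> i; rewrite !inE.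
rewrite -bigR_mask; apply: bigR_le => i _.
case fS: (f \in S i :\ e).
  by do 2 case: ifP => _;
    rewrite ?Rminus_0_r ?Rminus_diag ?Rabs_R0 ?Rminus_0_l ?Rabs_Ropp ?Rabs_R1; lra.
have sub (Z : {set T}) : (S i :\ e \subset Z) = (S i :\ e \subset Z :\ f).
  by rewrite subsetD1 fS andbT.
by rewrite (sub X) (sub Y) HXY Rminus_diag Rabs_R0; lra.
Qed.

(** Double counting: each copy through [e] is met by at most [m] choices of [f]. *)
Lemma sum_copies_pair {T I : finType} (A : {set I}) (S : I -> {set T}) (m : nat) e :
  (forall i, i \in A -> #|S i| = m) ->
  \big[Rplus/0]_f INR #|[set i in copies_at A S e | f \in S i :\ e]| <=
  INR #|copies_at A S e| * INR m.
Proof.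
move=> Hm; rewrite -bigR_const.
rewrite (eq_bigr (fun f => \big[Rplus/0]_(i in copies_at A S e) (if f \in S i :\ e then 1 else 0))).
  rewrite exchange_big /=; apply: bigR_le => i; rewrite inE => /andP[iA _].
  rewrite -INR_card -(Hm i iA); apply: le_INR; apply/leP.
  by apply: subset_leq_card; apply/subsetP => x; rewrite !inE => /andP[].
move=> f _; rewrite bigR_mask -(Rmult_1_r (INR _)) -bigR_const.
by apply: eq_bigl => i; rewrite inE.
Qed.

(** A copy through [e] still needs its other [m - 1] elements; this is the source of the exponent in
    [Psi]. *)
Lemma expect_gradient_copies {T I : finType} (A : {set I}) (S : I -> {set T}) (m : nat) q e :
  (forall i, i \in A -> #|S i| = m) ->
  expect q (gradient (fun Y => INR (copies A S Y)) e) =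
  INR #|copies_at A S e| * q ^ (m - 1).
Proof.
move=> Hm; rewrite -bigR_const /expect.
rewrite (resample_ext _ _ _ _ _ (gradient_copies A S e)) resample_sum.
apply: eq_bigr => i; rewrite inE => /andP[iA eS].
have := expect_subset q (S i :\ e); rewrite /expect => ->.
by rewrite -(Hm i iA) (cardsD1 e (S i)) eS add1n subn1.
Qed.

(** * Counting functions with prescribed values *)

Lemma card_ffun_pinned2 (V W : finType) (i j : V) (u v : W) :
  i != j -> #|[set s : {ffun V -> W} | (s i == u) && (s j == v)]| = (#|W| ^ (#|V| - 2))%N.
Proof.
move=> ij.
pose F k : pred W := if k == i then pred1 u else if k == j then pred1 v else predT.
have -> : #|[set s : {ffun V -> W} | (s i == u) && (s j == v)]| = #|family F|.
  apply: eq_card => s; rewrite !inE; apply/andP/familyP.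
    move=> [si sj] k; rewrite /F; case: (eqVneq k i) => [->|_] //.
    by case: (eqVneq k j) => [->|_].
  move=> H; have := H i; have := H j; rewrite /F !eqxx eq_sym (negbTE ij).
  by rewrite !inE => -> ->.
rewrite card_family foldrE big_map big_enum /=.
rewrite (bigD1 i) //= (bigD1 j) 1?eq_sym //= {1}/F eqxx card1 mul1n.
rewrite {1}/F eq_sym (negbTE ij) eqxx card1 mul1n.
rewrite (eq_bigr (fun=> #|W|)); last first.
  by move=> k /andP[/negbTE ki /negbTE kj]; rewrite /F ki kj; apply: eq_card.
rewrite prod_nat_const; congr (_ ^ _)%N.
rewrite -(cardsC [set i; j]) cards2 ij addKn.
by apply: eq_card => k; rewrite !inE negb_or.
Qed.

(* A constraint that determines the value at a further vertex [w] costs a factor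
   [#|W|]. *)
Lemma card_ffun_determined (V W : finType) (i j w : V) (u v : W)
    (Q : {set {ffun V -> W}}) :
  i != j -> w != i -> w != j ->
  Q \subset [set s : {ffun V -> W} | (s i == u) && (s j == v)] ->
  {in Q &, forall s t : {ffun V -> W}, (forall k, k != w -> s k = t k) -> s w = t w} ->
  (#|W| * #|Q| <= #|W| ^ (#|V| - 2))%N.
Proof.
move=> ij wi wj HQ Hdet.
rewrite -(card_ffun_pinned2 V W i j u v ij) mulnC -cardsT -cardsX.
(* Overwriting the value at [w] arbitrarily keeps the values at [i] and [j], and loses no
   information on [Q], where the value at [w] can be recovered from the others. *)
pose upd (p : {ffun V -> W} * W) := [ffun k => if k == w then p.2 else p.1 k].
rewrite -(card_in_imset (f := upd)).
  apply: subset_leq_card; apply/subsetP => s /imsetP[[t x] /setXP[/= tQ _] ->].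
  move/subsetP/(_ t tQ): HQ; rewrite !inE !ffunE /=.
  by rewrite [i == w]eq_sym (negbTE wi) [j == w]eq_sym (negbTE wj).
move=> [s x] [t y] /setXP[/= sQ _] /setXP[/= tQ _] /ffunP H.
have Hk k : k != w -> s k = t k by move=> kw; have := H k; rewrite !ffunE /= (negbTE kw).
have -> : s = t.
  apply/ffunP => k; case: (eqVneq k w) => [->|]; last exact: Hk.
  exact: Hdet.
by have := H w; rewrite !ffunE /= eqxx => ->.
Qed.

Lemma card_bigcup_le (I T : finType) (P : pred I) (F : I -> {set T}) :
  (#|\bigcup_(i | P i) F i| <= \sum_(i | P i) #|F i|)%N.
Proof.
apply: (big_ind2 (fun (A : {set T}) k => (#|A| <= k)%N)) => //; first by rewrite cards0.
by move=> A k B l HA HB; apply: leq_trans (leq_card_setU A B) (leq_add HA HB).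
Qed.

(** * Counting injections of a graph *)

(** Both orders of the endpoints are quantified, so for a symmetric [gadj] an edge is found
    whichever of its endpoints gets the smaller label. *)
Definition edge_image {n : nat} (G : sgraph) (sigma : {ffun 'I_(gv G) -> 'I_n}) : graph_t n :=
  [set e | [exists i, exists j,
    [&& @gadj G i j, sigma i == (val e).1 & sigma j == (val e).2]]].

Definition injections (V W : finType) : {set {ffun V -> W}} :=
  [set s : {ffun V -> W} | injectiveb s].

Lemma pair_fst_neq_snd {n : nat} (e : pair_t n) : (val e).1 != (val e).2.
Proof. by have := valP e; rewrite /= ltn_neqAle => /andP[]. Qed.

Lemma hom_count_copies {n : nat} (G : sgraph) (X : graph_t n) :
  simple_graph G ->
  hom_count G X = copies (injections 'I_(gv G) 'I_n) (@edge_image n G) X.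
Proof.
move=> [Gsym Girr]; apply: eq_card => s; rewrite !inE.
case sinj: (injectiveb s) => //=; move/injectiveP: sinj => sinj.
apply/idP/subsetP => [/forallP H e|H].
  rewrite inE => /existsP[i /existsP[j /and3P[ij /eqP si /eqP sj]]].
  have /existsP[e' /andP[e'X]] := implyP (forallP (H i) j) ij.
  rewrite si sj => /orP[/andP[/eqP E1 /eqP E2]|/andP[/eqP E1 /eqP E2]].
    suff -> : e = e' by [].
    by apply: val_inj; rewrite [LHS]surjective_pairing -E1 -E2 -surjective_pairing.
  have := valP e'; have := valP e; rewrite /= E1 E2 => H1 H2.
  by have := ltn_trans H1 H2; rewrite ltnn.
apply/forallP => i; apply/forallP => j; apply/implyP => ij.
have sij : s i != s j by apply/negP => /eqP/sinj E; rewrite E Girr in ij.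
have [lt|le] := ltnP (s i) (s j).
  apply/existsP; exists (exist _ (s i, s j) lt); rewrite /= !eqxx andbT H //.
  by rewrite inE; apply/existsP; exists i; apply/existsP; exists j; rewrite ij !eqxx.
have lt : (s j < s i)%N by rewrite ltn_neqAle le eq_sym andbT.
apply/existsP; exists (exist _ (s j, s i) lt); rewrite /= !eqxx orbT andbT H //.
by rewrite inE; apply/existsP; exists j; apply/existsP; exists i; rewrite Gsym ij !eqxx.
Qed.

(* Each edge gives two ordered adjacent pairs, exactly one of which is increasing
   for an injective labelling. *)
Lemma card_oriented_edges (G : sgraph) (k : 'I_(gv G) -> nat) :
  simple_graph G -> injective k ->
  #|[set p : 'I_(gv G) * 'I_(gv G) | @gadj G p.1 p.2]| =
  (2 * #|[set p : 'I_(gv G) * 'I_(gv G) | (k p.1 < k p.2)%N && @gadj G p.1 p.2]|)%N.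
Proof.
move=> [Gsym Girr] kinj.
pose sw (p : 'I_(gv G) * 'I_(gv G)) := (p.2, p.1).
have swK : involutive sw by case.
rewrite -(cardsID [set p | (k p.1 < k p.2)%N]) mul2n -addnn; congr (_ + _)%N.
  by apply: eq_card => p; rewrite !inE andbC.
rewrite -[RHS](card_imset _ (inv_inj swK)); apply: eq_card => p; rewrite !inE.
apply/andP/imsetP => [[H1 H2]|[p' H ->]].
  exists (sw p); last by rewrite swK.
  rewrite inE /= Gsym H2 andbT ltn_neqAle leqNgt H1 andbT.
  by apply: contraTneq H2 => /kinj ->; rewrite Girr.
move: H; rewrite inE => /andP[H1 H2] /=.
by rewrite Gsym H2 -leqNgt ltnW.
Qed.

Lemma card_adjacent_pairs (G : sgraph) :
  simple_graph G ->
  #|[set p : 'I_(gv G) * 'I_(gv G) | @gadj G p.1 p.2]| = (2 * num_edges G)%N.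
Proof. by move=> HG; rewrite (card_oriented_edges G (@nat_of_ord _)) //; exact: val_inj. Qed.

(** An image pair corresponds to the orientation of an edge along which [s] increases. By
    [card_oriented_edges], ordering by [s] and ordering by vertex number select equally many
    oriented edges. *)
Lemma card_edge_image {n : nat} (G : sgraph) (s : {ffun 'I_(gv G) -> 'I_n}) :
  simple_graph G -> injective s -> #|edge_image G s| = num_edges G.
Proof.
move=> HG sinj.
have kinj : injective (fun i => nat_of_ord (s i)) by move=> i j /val_inj/sinj.
have := card_oriented_edges G _ HG kinj; rewrite card_adjacent_pairs // => /eqP.
rewrite eqn_mul2l /= => /eqP ->.
pose f (e : pair_t n) := val e.
rewrite -(card_imset _ (val_inj : injective f)).
pose g (p : 'I_(gv G) * 'I_(gv G)) := (s p.1, s p.2).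
have ginj : injective g by move=> [a b] [c d] /= [/sinj -> /sinj ->].
rewrite -[RHS](card_imset _ ginj); apply: eq_card => p; apply/imsetP/imsetP.
  move=> [e]; rewrite inE => /existsP[i /existsP[j /and3P[ij /eqP si /eqP sj]]] ->.
  exists (i, j); last by rewrite /g /= si sj -surjective_pairing.
  by rewrite inE /= ij andbT si sj; exact: (valP e).
move=> [[i j]]; rewrite inE /= => /andP[lt ij] ->.
exists (exist _ (s i, s j) lt) => //.
by rewrite inE; apply/existsP; exists i; apply/existsP; exists j; rewrite ij !eqxx.
Qed.

Definition pinned {n : nat} (G : sgraph) (e : pair_t n) (p : 'I_(gv G) * 'I_(gv G)) :
    {set {ffun 'I_(gv G) -> 'I_n}} :=
  [set s : {ffun 'I_(gv G) -> 'I_n} | (s p.1 == (val e).1) && (s p.2 == (val e).2)].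

Notation embeddings_at G e := (copies_at (injections 'I_(gv G) 'I__) (@edge_image _ G) e).

(** By injectivity, an embedding whose image uses [e] does so through exactly one ordered adjacent
    pair. *)
Lemma card_embeddings_at {n : nat} (G : sgraph) (e : pair_t n) :
  simple_graph G ->
  #|embeddings_at G e| =
  (\sum_(p | @gadj G p.1 p.2) #|injections 'I_(gv G) 'I_n :&: pinned G e p|)%N.
Proof.
move=> HG.
have E (p : 'I_(gv G) * 'I_(gv G)) : #|injections 'I_(gv G) 'I_n :&: pinned G e p| =
    (\sum_(s in injections 'I_(gv G) 'I_n) (s \in pinned G e p))%N.
  rewrite -sum1_card big_mkcond [RHS]big_mkcond; apply: eq_bigr => s _.
  by rewrite in_setI; case: (s \in injections _ _); case: (s \in pinned _ _ _).
rewrite (eq_bigr _ (fun p _ => E p)) exchange_big /= -sum1_card big_mkcond.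
rewrite [RHS]big_mkcond; apply: eq_bigr => s _; rewrite !inE.
case sinj: (injectiveb s) => //=; move/injectiveP: sinj => sinj.
case: existsP => [[i /existsP[j /and3P[ij /eqP si /eqP sj]]]|H].
  rewrite (bigD1 (i, j)) //= inE si sj !eqxx big1 // => -[a b] /= /andP[_ ne].
  apply/eqP; rewrite inE eqb0 /= -si -sj; apply: contra ne => /andP[/eqP/sinj -> /eqP/sinj ->].
  by [].
rewrite big1 // => -[i j] /= ij; apply/eqP; rewrite inE eqb0; apply/negP => /andP[/= si sj].
by apply: H; exists i; apply/existsP; exists j; rewrite ij si.
Qed.

Lemma leq_mul_sum_card (I : finType) (P : pred I) (F : I -> nat) (n b c : nat) :
  (#|P| <= c)%N -> (forall i, P i -> (n * F i <= b)%N) ->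
  (n * \sum_(i | P i) F i <= c * b)%N.
Proof.
move=> Hc H; rewrite big_distrr /=; apply: (@leq_trans (\sum_(i | P i) b)%N); first exact: leq_sum.
by rewrite sum_nat_const leq_mul2r Hc orbT.
Qed.

(** The ends of [e] are distinct, so any collision involves a vertex [q.2] outside [p]. Its value is
    determined by that at [q.1], which saves a factor [n] for each of the at most [gv G ^ 2] pairs
    [q]. *)
Lemma card_pinned_not_injective {n : nat} (G : sgraph) (e : pair_t n) p :
  p.1 != p.2 ->
  (n * #|pinned G e p :\: injections 'I_(gv G) 'I_n| <= gv G ^ 2 * n ^ (gv G - 2))%N.
Proof.
move=> ij; set P := fun q : 'I_(gv G) * 'I_(gv G) => [&& q.1 != q.2, q.2 != p.1 & q.2 != p.2].
have Hsub : pinned G e p :\: injections 'I_(gv G) 'I_n \subset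
    \bigcup_(q | P q) [set s in pinned G e p | s q.2 == s q.1].
  apply/subsetP => s /setDP[sP]; rewrite inE => /injectivePn[a [b ab sab]].
  have [Hb|Hb] := boolP ((b != p.1) && (b != p.2)).
    apply/bigcupP; exists (a, b); first by rewrite /P /= ab.
    by rewrite inE sP /= sab.
  apply/bigcupP; exists (b, a); last by rewrite inE sP /= sab.
  rewrite /P /= eq_sym ab /=.
  move: sP; rewrite inE => /andP[/eqP s1 /eqP s2].
  have ne := pair_fst_neq_snd e.
  move: Hb; rewrite negb_and !negbK => /orP[/eqP Eb|/eqP Eb]; subst b.
    rewrite ab /=; apply: contraNneq ne => Ea; subst a.
    by rewrite -s1 -s2 sab.
  rewrite ab andbT; apply: contraNneq ne => Ea; subst a.
  by rewrite -s1 -s2 sab.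
apply: leq_trans (_ : n * \sum_(q | P q) #|[set s in pinned G e p | s q.2 == s q.1]| <= _)%N.
  by rewrite leq_mul2l (leq_trans (subset_leq_card Hsub) (card_bigcup_le _ _ _ _)) orbT.
apply: leq_mul_sum_card.
  by apply: leq_trans (max_card _) _; rewrite card_prod card_ord.
move=> [a b] /and3P[/= ab b1 b2].
have := card_ffun_determined _ _ p.1 p.2 b (val e).1 (val e).2 [set s in pinned G e p | s b == s a].
rewrite !card_ord; apply=> //.
  by apply/subsetP => s; rewrite !inE => /andP[].
by move=> s t; rewrite !inE => /andP[_ /eqP ->] /andP[_ /eqP ->]; apply.
Qed.

Lemma card_embeddings_at_le {n : nat} (G : sgraph) (e : pair_t n) :
  simple_graph G ->
  (#|embeddings_at G e| <= 2 * num_edges G * n ^ (gv G - 2))%N.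
Proof.
move=> HG; rewrite card_embeddings_at // -card_adjacent_pairs // -sum_nat_const.
rewrite [X in (_ <= X)%N](eq_bigl (fun p => @gadj G p.1 p.2)); last by move=> p; rewrite inE.
apply: leq_sum => p adjp.
have ij : p.1 != p.2 by apply: contraTneq adjp => ->; rewrite HG.2.
apply: leq_trans (subset_leq_card (subsetIr _ _)) _.
by rewrite card_ffun_pinned2 // !card_ord.
Qed.

(** Only the non-injective pinned maps are lost, so with [card_embeddings_at_le] the count is known
    up to a relative error of order [1 / n]. The factor [n] on both sides avoids division. *)
Lemma card_embeddings_at_ge {n : nat} (G : sgraph) (e : pair_t n) :
  simple_graph G ->
  (n * (2 * num_edges G * n ^ (gv G - 2)) <=
   n * #|embeddings_at G e| + 2 * num_edges G * (gv G ^ 2 * n ^ (gv G - 2)))%N.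
Proof.
move=> HG; rewrite card_embeddings_at // -card_adjacent_pairs //.
have setE F : (\sum_(p in [set p : 'I_(gv G) * 'I_(gv G) | @gadj G p.1 p.2]) F p =
    \sum_(p | @gadj G p.1 p.2) F p)%N by apply: eq_bigl => p; rewrite inE.
rewrite -!sum_nat_const !setE !big_distrr /=.
rewrite -big_split /=; apply: leq_sum => p adjp.
have ij : p.1 != p.2 by apply: contraTneq adjp => ->; rewrite HG.2.
have := card_pinned_not_injective G e p ij.
have := card_ffun_pinned2 _ _ p.1 p.2 (val e).1 (val e).2 ij; rewrite !card_ord => <-.
rewrite -/(pinned G e p) => H.
by rewrite -{1}(cardsID (injections 'I_(gv G) 'I_n) (pinned G e p)) mulnDr setIC leq_add2l.
Qed.

(** A pair [f] different from [e] has an end that is the image of a third vertex [k]. Fixing that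
    value saves a factor [n]; the index records the pair sent to [e], the vertex [k], and which end
    of [f] it hits. *)
Lemma card_embeddings_at_two {n : nat} (G : sgraph) (e f : pair_t n) :
  simple_graph G ->
  (n * #|[set s in embeddings_at G e | f \in edge_image G s :\ e]| <=
   2 * gv G ^ 3 * n ^ (gv G - 2))%N.
Proof.
move=> HG.
set P := fun q : 'I_(gv G) * 'I_(gv G) * 'I_(gv G) * bool =>
  [&& q.1.1.1 != q.1.1.2, q.1.2 != q.1.1.1 & q.1.2 != q.1.1.2].
pose F (q : 'I_(gv G) * 'I_(gv G) * 'I_(gv G) * bool) :=
  [set s in pinned G e q.1.1 | s q.1.2 == if q.2 then (val f).1 else (val f).2].
have Hsub : [set s in embeddings_at G e | f \in edge_image G s :\ e] \subset
    \bigcup_(q | P q) F q.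
  apply/subsetP => s; rewrite !inE => /andP[/andP[/injectiveP sinj]].
  move=> /existsP[i /existsP[j /and3P[ij si sj]]] /andP[fe].
  move=> /existsP[k /existsP[l /and3P[kl sk sl]]].
  have ij' : i != j by apply: contraTneq ij => ->; rewrite HG.2.
  have [Hk|Hk] := boolP ((k != i) && (k != j)).
    by apply/bigcupP; exists (i, j, k, true); rewrite /P /= ?ij' // !inE /= si sj.
  have [Hl|Hl] := boolP ((l != i) && (l != j)).
    by apply/bigcupP; exists (i, j, l, false); rewrite /P /= ?ij' // !inE /= si sj.
  (* If both ends of [f] come from [i] and [j], then [f] would be a loop, [e] itself, or [e]
     reversed; the last contradicts the ordering inside pairs. *)
  exfalso; have lf := valP f; have le := valP e.
  have nf := pair_fst_neq_snd f.
  move: Hk Hl; rewrite !negb_and !negbK.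
  move/eqP: si => si; move/eqP: sj => sj; move/eqP: sk => sk; move/eqP: sl => sl.
  move=> /orP[]/eqP Ek /orP[]/eqP El; subst k l.
  - by rewrite -sk -sl eqxx in nf.
  - case/negP: fe; apply/eqP/val_inj.
    by rewrite [LHS]surjective_pairing -sk -sl si sj -surjective_pairing.
  - by have := ltn_trans lf; rewrite /= -sk -sl si sj => /(_ _ le); rewrite ltnn.
  - by rewrite -sk -sl eqxx in nf.
apply: leq_trans (_ : n * \sum_(q | P q) #|F q| <= _)%N.
  by rewrite leq_mul2l (leq_trans (subset_leq_card Hsub) (card_bigcup_le _ _ _ _)) orbT.
apply: leq_mul_sum_card.
  apply: leq_trans (max_card _) _.
  by rewrite !card_prod !card_ord card_bool mulnC !expnS expn0 muln1 !mulnA.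
move=> [[[i j] k] b] /and3P[/= ij ki kj].
have := card_ffun_determined _ _ i j k (val e).1 (val e).2 (F (i, j, k, b)).
rewrite !card_ord; apply=> //.
  by apply/subsetP => s; rewrite !inE => /andP[].
by move=> s t; rewrite !inE => /andP[_ /eqP ->] /andP[_ /eqP ->].
Qed.

(** * The Hamiltonian *)

(** The three summands serve, in order, the influence of one pair on a gradient, the total
    influence, and the error in the mean. *)
Definition graph_const (G : sgraph) : R :=
  INR (2 * gv G ^ 3 + 2 * num_edges G * num_edges G + 2 * num_edges G * gv G ^ 2).

Definition energy_term (n : nat) (G : sgraph) (b : R) (X : graph_t n) : R :=
  b * INR (hom_count G X) / powerRZ (INR n) (Z.of_nat (gv G) - 2).

Lemma mem_injections {V W : finType} (s : {ffun V -> W}) :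
  s \in injections V W -> injective s.
Proof. by rewrite inE => /injectiveP. Qed.

Lemma INR_leq (m n : nat) : (m <= n)%N -> INR m <= INR n.
Proof. by move=> H; apply: le_INR; apply/leP. Qed.

Lemma INR_mul (m n : nat) : INR (m * n)%N = INR m * INR n.
Proof. by rewrite -multE mult_INR. Qed.

Lemma INR_add (m n : nat) : INR (m + n)%N = INR m + INR n.
Proof. by rewrite -plusE plus_INR. Qed.

Lemma INR_expn (m n : nat) : INR (m ^ n)%N = INR m ^ n.
Proof. by elim: n => [|n IH] //=; rewrite expnS INR_mul IH. Qed.

(** The exponent is an integer in the Hamiltonian and a truncated natural number here. They agree
    for at least two vertices; with fewer there are no edges and both sides vanish. *)
Lemma gradient_energy_term {n : nat} (G : sgraph) (b : R) (e : pair_t n) (X : graph_t n) :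
  (0 < n)%N -> simple_graph G ->
  gradient (energy_term n G b) e X =
  b / INR (n ^ (gv G - 2)) *
  gradient (fun Y => INR (copies (injections 'I_(gv G) 'I_n) (@edge_image n G) Y)) e X.
Proof.
move=> n0 HG.
have E : gradient (energy_term n G b) e X = b / powerRZ (INR n) (Z.of_nat (gv G) - 2) *
  gradient (fun Y => INR (copies (injections 'I_(gv G) 'I_n) (@edge_image n G) Y)) e X.
  by rewrite /gradient /energy_term !hom_count_copies // /Rdiv; ring.
rewrite {}E; have [v2|v2] := leqP 2 (gv G).
  rewrite INR_expn pow_powerRZ; do 3 f_equal.
  by rewrite -minusE; move/leP: v2; lia.
rewrite gradient_copies big1 ?Rmult_0_r // => s.
rewrite inE => /andP[/mem_injections sinj]; rewrite inE.
move=> /existsP[i /existsP[j /and3P[ij _ _]]]; exfalso.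
have E : i = j.
  by apply: val_inj; move: (ltn_ord i) (ltn_ord j) v2 => /ltP Hi /ltP Hj /ltP Hv /=; lia.
by move: ij; rewrite E HG.2.
Qed.

(** Monotonicity needs [b] nonnegative, except for a single edge, where the gradient does not depend
    on [X]; this admits an arbitrary sign for [K2]. The influences come from
    [card_embeddings_at_two], their sum from [card_embeddings_at_le]. *)
Lemma energy_term_tame {n : nat} (G : sgraph) (b : R) :
  (0 < n)%N -> simple_graph G -> 0 <= b \/ num_edges G = 1%N ->
  tame (energy_term n G b) (Rabs b * graph_const G / INR n) (Rabs b * graph_const G).
Proof.
move=> n0 HG Hb.
have N0 : 0 < INR n by apply: lt_0_INR; apply/ltP.
set D := INR (n ^ (gv G - 2)).
have D0 : 0 < D by apply: lt_0_INR; apply/ltP; rewrite expn_gt0 n0.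
have rD : Rabs (b / D) = Rabs b / D by rewrite Rabs_mult Rabs_inv (Rabs_pos_eq D) //; lra.
have Hm s : s \in injections 'I_(gv G) 'I_n -> #|edge_image G s| = num_edges G.
  by move=> /mem_injections; apply: card_edge_image.
have b0 := Rabs_pos b.
split.
  move=> e X Y HXY; rewrite !gradient_energy_term // !gradient_copies.
  case: Hb => [Hb|m1].
    apply: Rmult_le_compat_l; first by apply: Rle_mult_inv_pos.
    apply: bigR_le => s _; case: ifP => HX; last by case: ifP; lra.
    by rewrite (subset_trans HX HXY); lra.
  apply: Req_le; congr (_ * _); apply: eq_bigr => s; rewrite inE => /andP[sA es].
  have -> : edge_image G s :\ e = set0.
    by apply/eqP; rewrite -cards_eq0; have := Hm s sA; rewrite (cardsD1 e) es m1 add1n => -[->].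
  by rewrite !sub0set.
exists (fun e f => Rabs b / D * INR #|[set s in embeddings_at G e | f \in edge_image G s :\ e]|).
split.
- move=> e f; split.
    by apply: Rmult_le_pos; [apply: Rle_mult_inv_pos | apply: pos_INR].
  have := INR_leq _ _ (card_embeddings_at_two G e f HG).
  rewrite !(INR_mul _ (n ^ _)) (INR_mul n) -/D => H.
  set k := INR #|_| in H *.
  have HK : INR (2 * gv G ^ 3) <= graph_const G.
    by apply: INR_leq; rewrite -addnA leq_addr.
  have -> : Rabs b / D * k = Rabs b * (INR n * k) / (INR n * D) by field; lra.
  apply: (Rmult_le_reg_r (INR n * D)); first exact: Rmult_lt_0_compat.
  have -> : Rabs b * (INR n * k) / (INR n * D) * (INR n * D) = Rabs b * (INR n * k) by field; lra.
  have -> : Rabs b * graph_const G / INR n * (INR n * D) =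
    Rabs b * (graph_const G * D) by field; lra.
  by apply: Rmult_le_compat_l => //; nra.
- move=> e; rewrite -big_distrr /=.
  have H1 := sum_copies_pair _ _ _ e Hm.
  have H2 := INR_leq _ _ (card_embeddings_at_le G e HG).
  rewrite INR_mul -/D in H2.
  set S := \big[Rplus/0]_f _ in H1 *.
  have HK : INR (2 * num_edges G) * INR (num_edges G) <= graph_const G.
    by rewrite -INR_mul; apply: INR_leq; rewrite -addnA addnCA leq_addr.
  have m0 := pos_INR (num_edges G).
  have HS : S <= graph_const G * D by nra.
  have -> : Rabs b / D * S = Rabs b * (S / D) by field; lra.
  apply: Rmult_le_compat_l => //; apply: (Rmult_le_reg_r D) => //.
  by have -> : S / D * D = S by field; lra.
- move=> e f X Y HXY; rewrite !gradient_energy_term // -Rmult_minus_distr_l Rabs_mult -/D rD.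
  apply: Rmult_le_compat_l; first exact: Rle_mult_inv_pos.
  exact: gradient_copies_lipschitz.
Qed.

(** The mean is exactly proportional to the number of embeddings through [e], so the error is the
    one left by [card_embeddings_at_le] and [card_embeddings_at_ge]. *)
Lemma expect_energy_term {n : nat} (G : sgraph) (b q : R) (e : pair_t n) :
  (0 < n)%N -> simple_graph G -> 0 <= q <= 1 ->
  Rabs (expect q (gradient (energy_term n G b) e) -
        2 * b * INR (num_edges G) * q ^ (num_edges G - 1)) <=
  Rabs b * graph_const G / INR n.
Proof.
move=> n0 HG Hq.
have N0 : 0 < INR n by apply: lt_0_INR; apply/ltP.
set D := INR (n ^ (gv G - 2)).
have D0 : 0 < D by apply: lt_0_INR; apply/ltP; rewrite expn_gt0 n0.
have b0 := Rabs_pos b.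
rewrite /expect (resample_ext _ _ _ _ _ (fun X => gradient_energy_term G b e X n0 HG)).
rewrite resample_scale -/D -/(expect _ _) (expect_gradient_copies _ _ (num_edges G)); last first.
  by move=> s /mem_injections; apply: card_edge_image.
set M := INR #|_|; set Q := q ^ _; set m := INR (num_edges G).
have HQ : 0 <= Q <= 1.
  split; first by apply: pow_le; lra.
  by rewrite -(pow1 (num_edges G - 1)); apply: pow_incr; lra.
have H2 : M <= 2 * m * D.
  have := INR_leq _ _ (card_embeddings_at_le G e HG).
  by rewrite !INR_mul -/D -/M.
have H3 : INR n * (2 * m * D - M) <= graph_const G * D.
  have := INR_leq _ _ (card_embeddings_at_ge G e HG).
  rewrite mulnA INR_add mulnA mulnA INR_mul INR_mul INR_mul INR_mul (INR_mul _ (n ^ _)).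
  rewrite -/D -/M [INR 2]/= -/m => H.
  have HK : INR (2 * num_edges G * gv G ^ 2) <= graph_const G by apply: INR_leq; rewrite leq_addl.
  by nra.
have -> : b / D * (M * Q) - 2 * b * m * Q = - (b * (Q * ((2 * m * D - M) / D))) by field; lra.
rewrite Rabs_Ropp Rabs_mult.
have -> : Rabs b * graph_const G / INR n = Rabs b * (graph_const G / INR n) by field; lra.
apply: Rmult_le_compat_l => //.
have X0 : 0 <= (2 * m * D - M) / D by apply: Rle_mult_inv_pos; lra.
rewrite Rabs_pos_eq; last by apply: Rmult_le_pos; lra.
apply: Rle_trans (_ : (2 * m * D - M) / D <= _); first by set x := _ / D in X0 *; nra.
apply: (Rmult_le_reg_r (INR n * D)); first exact: Rmult_lt_0_compat.
have -> : (2 * m * D - M) / D * (INR n * D) = INR n * (2 * m * D - M) by field; lra.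
by have -> : graph_const G / INR n * (INR n * D) = graph_const G * D by field; lra.
Qed.

Lemma gradient_sum {T : finType} (s : nat) (F : nat -> {set T} -> R) e X :
  gradient (fun Y => \big[Rplus/0]_(i < s) F i Y) e X =
  \big[Rplus/0]_(i < s) gradient (F i) e X.
Proof. by rewrite /gradient -bigR_sub. Qed.

Lemma tame_sum {T : finType} (s : nat) (F : nat -> {set T} -> R) (kap C : nat -> R) :
  (forall i, (i < s)%N -> tame (F i) (kap i) (C i)) ->
  tame (fun X => \big[Rplus/0]_(i < s) F i X)
    (\big[Rplus/0]_(i < s) kap i) (\big[Rplus/0]_(i < s) C i).
Proof.
move=> H; split.
  move=> e X Y HXY; rewrite !gradient_sum; apply: bigR_le => i _.
  by have [Hi _] := H i (ltn_ord i); apply: Hi.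
have [c Hc] := fin_all_exists (fun i : 'I_s => tame_lipschitz _ _ _ (H i (ltn_ord i))).
exists (fun e f => \big[Rplus/0]_(i < s) c i e f); split.
- move=> e f; split.
    by apply: bigR_ge0 => i _; have [/(_ e f)[Hk _] _ _] := Hc i.
  by apply: bigR_le => i _; have [/(_ e f)[_ Hk] _ _] := Hc i.
- move=> e; rewrite exchange_big /=; apply: bigR_le => i _.
  by have [_ /(_ e) Hk _] := Hc i.
- move=> e f X Y HXY; rewrite !gradient_sum -bigR_sub.
  apply: Rle_trans (bigR_abs _ _ _) _; apply: bigR_le => i _.
  by have [_ _ /(_ e f X Y HXY)] := Hc i.
Qed.

Definition ham_const (s : nat) (G : nat -> sgraph) (beta : nat -> R) : R :=
  \big[Rplus/0]_(i < s) (Rabs (beta i) * graph_const (G i)).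

Lemma ham_const_ge0 s G beta : 0 <= ham_const s G beta.
Proof.
by apply: bigR_ge0 => i _; apply: Rmult_le_pos; [apply: Rabs_pos | apply: pos_INR].
Qed.

Lemma num_edges_K2 : num_edges K2 = 1%N.
Proof.
rewrite /num_edges -(cards1 (@ord0 1, @ord_max 1)); apply: eq_card => -[[i Hi] [j Hj]].
rewrite !inE /= xpair_eqE -!val_eqE /=.
by case: i Hi => [|[|]] //; case: j Hj => [|[|]].
Qed.

Lemma hamiltonianE n s G beta (X : graph_t n) :
  hamiltonian n s G beta X = \big[Rplus/0]_(i < s) energy_term n (G i) (beta i) X.
Proof. by rewrite /hamiltonian rsum_natE. Qed.

Lemma hamiltonian_tame n s G beta :
  (0 < n)%N -> (forall i, (i < s)%N -> simple_graph (G i)) -> G 0%nat = K2 ->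
  (forall i, (1 <= i < s)%N -> 0 < beta i) ->
  tame (hamiltonian n s G beta) (ham_const s G beta / INR n) (ham_const s G beta).
Proof.
move=> n0 HG HG0 Hbeta.
have H i : (i < s)%N -> tame (energy_term n (G i) (beta i))
    (Rabs (beta i) * graph_const (G i) / INR n) (Rabs (beta i) * graph_const (G i)).
  move=> Hi; apply: energy_term_tame => //; first exact: HG.
  case: i Hi => [|i] Hi; first by right; rewrite HG0 num_edges_K2.
  by left; apply: Rlt_le; apply: Hbeta.
have := tame_sum s _ _ _ H.
rewrite -/(ham_const _ _ _) /Rdiv -big_distrl /= -/(ham_const _ _ _).
case=> Hi [c [c0 cC cL]]; split.
  by move=> e X Y HXY; have := Hi e X Y HXY; rewrite /gradient !hamiltonianE.
exists c; split=> // e f X Y HXY.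
by have := cL e f X Y HXY; rewrite /gradient !hamiltonianE.
Qed.

Lemma expect_hamiltonian n s G beta q (e : pair_t n) :
  (0 < n)%N -> (forall i, (i < s)%N -> simple_graph (G i)) -> 0 <= q <= 1 ->
  Rabs (expect q (gradient (hamiltonian n s G beta) e) - Psi s G beta q) <=
  ham_const s G beta / INR n.
Proof.
move=> n0 HG Hq; rewrite /Psi rsum_natE.
have -> : expect q (gradient (hamiltonian n s G beta) e) =
    \big[Rplus/0]_(i < s) expect q (gradient (energy_term n (G i) (beta i)) e).
  rewrite /expect -resample_sum; apply: resample_ext => X.
  by rewrite -(gradient_sum s (fun i => energy_term n (G i) (beta i))) /gradient !hamiltonianE.
rewrite -bigR_sub; apply: Rle_trans (bigR_abs _ _ _) _.
rewrite /ham_const /Rdiv big_distrl /=; apply: bigR_le => i _.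
by apply: expect_energy_term => //; apply: HG.
Qed.

(** * Exponential rates for the two bottleneck sets *)

Lemma sqr_le_exp (b : R) : 0 < b -> exists N : nat, forall n : nat, (N <= n)%N ->
  INR n ^ 2 <= exp (b * INR n).
Proof.
(* The exponential is at least [(b * n / 3) ^ 3], which is [n ^ 2] times [b ^ 3 * n / 27]; the
   threshold makes the last factor at least [1]. *)
move=> b0; have [N HN] := INR_unbounded (27 / b ^ 3).
exists N => n Hn.
have Hn' : 27 / b ^ 3 <= INR n by have := INR_leq _ _ Hn; lra.
have n0 := pos_INR n.
have -> : b * INR n = b * INR n / 3 + b * INR n / 3 + b * INR n / 3 by field.
have H := exp_ineq1_le (b * INR n / 3).
rewrite !exp_plus; set E := exp _ in H *; set x := b * INR n / 3 in H.
have x0 : 0 <= x by rewrite /x; nra.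
apply: Rle_trans (_ : x * x * x <= _); last first.
  by apply: Rmult_le_compat; [nra|lra|apply: Rmult_le_compat; lra|lra].
have -> : x * x * x = INR n ^ 2 * (b ^ 3 * INR n / 27) by rewrite /x; field.
have H27 : 1 <= b ^ 3 * INR n / 27.
  have b3 : 0 < b ^ 3 by apply: pow_lt.
  have := Rmult_le_compat_l _ _ _ (Rlt_le _ _ b3) Hn'.
  have -> : b ^ 3 * (27 / b ^ 3) = 27 by field; lra.
  by lra.
have : 0 <= INR n ^ 2 by apply: pow_le.
by nra.
Qed.

(** Choice of parameters for the boundary estimates: [eta] is the distance between [Psi q] and [h],
    [delta] is [eta / 4] and [theta] is of order [n]. The bound [C / n <= eta / 2] absorbs the error
    in the mean, and [n ^ 2] bounds the number of pairs. *)
Lemma escape_rate (C eta : R) (f : nat -> nat) :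
  0 <= C -> 0 < eta -> little_o_n f ->
  exists b : R, 0 < b /\ exists N : nat, forall n : nat, (N <= n)%N ->
  [/\ (1 < n)%N, C / INR n <= eta / 2, INR (f n) * (C / INR n) <= eta / 4 &
   exists theta : R, [/\ 0 <= theta, theta * (C / INR n) <= / 4 &
    INR n ^ 2 * exp (- (theta * (eta / 4)) + theta ^ 2 * (C / INR n * C)) <=
    exp (- (b * INR n))]].
Proof.
move=> C0 eta0 Hf.
(* Small enough for [tau * C <= / 4] and for the quadratic term to take at most half of the linear
   gain [tau * (eta / 4)]. Using [C + 1] avoids dividing by zero. *)
set tau := Rmin 1 eta / (16 * (C + 1) ^ 2).
have C2 : 0 < 16 * (C + 1) ^ 2 by nra.
have m0 : 0 < Rmin 1 eta by apply: Rmin_glb_lt; lra.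
have tau0 : 0 < tau by apply: Rdiv_lt_0_compat.
have tauE : tau * (16 * (C + 1) ^ 2) = Rmin 1 eta by rewrite /tau; field; nra.
have m1 := Rmin_l 1 eta; have m2 := Rmin_r 1 eta.
have tauC : tau * C <= / 4 by nra.
have tauC2 : tau * C ^ 2 <= eta / 8 by nra.
set b := tau * (eta / 8).
have b0 : 0 < b by rewrite /b; nra.
have [N1 HN1] := sqr_le_exp (b / 2) ltac:(lra).
have Heps : 0 < eta / (4 * (C + 1)) by apply: Rdiv_lt_0_compat; lra.
have [N2 HN2] := Hf _ Heps.
have [N3 HN3] := INR_unbounded (2 * C / eta).
(* Half of the rate [b] pays for the factor [n ^ 2]. *)
exists (b / 2); split; first by lra.
exists (2 + (N1 + (N2 + N3)))%N => n Hn.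
have n2 : (2 <= n)%N by apply: leq_trans Hn; apply: leq_addr.
have n1 : (N1 <= n)%N by apply: leq_trans Hn; rewrite addnCA leq_addr.
have nN2 : (N2 <= n)%N by apply: leq_trans Hn; rewrite addnA addnCA leq_addr.
have nN3 : (N3 <= n)%N by apply: leq_trans Hn; rewrite !addnA leq_addl.
have n0 : 0 < INR n by apply: lt_0_INR; apply/ltP; apply: leq_trans n2.
have HCn : C / INR n <= eta / 2.
  apply: (Rmult_le_reg_r (INR n)) => //.
  have -> : C / INR n * INR n = C by field; lra.
  have H : 2 * C / eta <= INR n by have := INR_leq _ _ nN3; lra.
  have := Rmult_le_compat_l _ _ _ (Rlt_le _ _ eta0) H.
  have -> : eta * (2 * C / eta) = 2 * C by field; lra.
  by lra.
split=> //.
  apply: (Rmult_le_reg_r (INR n)) => //.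
  have -> : INR (f n) * (C / INR n) * INR n = INR (f n) * C by field; lra.
  have := HN2 n nN2; have fn0 := pos_INR (f n) => H.
  apply: Rle_trans (_ : INR (f n) * (C + 1) <= _); first by nra.
  have := Rmult_le_compat_r (C + 1) _ _ ltac:(lra) H.
  have -> : eta / (4 * (C + 1)) * INR n * (C + 1) = eta / 4 * INR n by field; lra.
  by [].
exists (tau * INR n); split; first by nra.
  have -> : tau * INR n * (C / INR n) = tau * C by field; lra.
  by [].
have -> : (tau * INR n) ^ 2 * (C / INR n * C) = tau * INR n * (tau * C ^ 2) by field; lra.
apply: Rle_trans (_ : exp (b / 2 * INR n) * exp (- (b * INR n)) <= _); last first.
  by rewrite -exp_plus; apply: exp_le_mono; lra.
apply: Rmult_le_compat; [by apply: pow_le; lra|exact: Rlt_le (exp_pos _)|exact: HN1|].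
apply: exp_le_mono; rewrite /b.
have : 0 < tau * INR n by nra.
by nra.
Qed.

Lemma card_pairs_le n : INR #|{: pair_t n}| <= INR n ^ 2.
Proof.
rewrite -INR_expn; apply: INR_leq.
apply: (@leq_trans #|{: 'I_n * 'I_n}|).
  exact: leq_card val_inj.
by rewrite card_prod card_ord.
Qed.

Lemma sublevel_escape s G beta q (f : nat -> nat) :
  let h := ln (q / (1 - q)) in
  (forall i, (i < s)%N -> simple_graph (G i)) -> G 0%nat = K2 ->
  (forall i, (1 <= i < s)%N -> 0 < beta i) ->
  0 < q < 1 -> Psi s G beta q < h -> little_o_n f ->
  exists b : R, 0 < b /\ exists N : nat, forall n : nat, (N <= n)%N ->
  let H := hamiltonian n s G beta in let A := sublevel H h in
  set0 \in A /\
  \big[Rplus/0]_(X in A :&: boundary A (f n)) exp (H X) <=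
  exp (- (b * INR n)) * \big[Rplus/0]_(X in A) exp (H X).
Proof.
move=> h HG HG0 Hbeta Hq HPsi Hf.
have C0 := ham_const_ge0 s G beta; set C := ham_const s G beta in C0.
have eta0 : 0 < h - Psi s G beta q by lra.
have [b [b0 [N HN]]] := escape_rate C _ f C0 eta0 Hf.
exists b; split=> //; exists N => n /HN[n1 HC Hk [theta [t0 tk Hexp]]] H A.
have n0 : (0 < n)%N by apply: leq_trans n1.
have Cn0 : 0 <= C / INR n by apply: Rle_mult_inv_pos => //; apply: lt_0_INR; apply/ltP.
have Hmean e : expect q (gradient H e) <= h - 2 * ((h - Psi s G beta q) / 4).
  have := expect_hamiltonian n s G beta q e n0 HG ltac:(lra); rewrite -/C -/H.
  by split_Rabs; lra.
have [|HA Hsum] := sublevel_boundary H q (C / INR n) C _ theta (f n) Hq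
  (hamiltonian_tame n s G beta n0 HG HG0 Hbeta) Cn0 _ t0 Hmean tk Hk; first by lra.
split=> //; apply: Rle_trans Hsum _; apply: Rmult_le_compat_r.
  by apply: bigR_ge0 => X _; apply: Rlt_le; apply: exp_pos.
apply: Rle_trans Hexp; apply: Rmult_le_compat_r; first exact: Rlt_le (exp_pos _).
exact: card_pairs_le.
Qed.

Lemma superlevel_escape s G beta q (f : nat -> nat) :
  let h := ln (q / (1 - q)) in
  (forall i, (i < s)%N -> simple_graph (G i)) -> G 0%nat = K2 ->
  (forall i, (1 <= i < s)%N -> 0 < beta i) ->
  0 < q < 1 -> h < Psi s G beta q -> little_o_n f ->
  exists b : R, 0 < b /\ exists N : nat, forall n : nat, (N <= n)%N ->
  let H := hamiltonian n s G beta in let A := superlevel H h in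
  setT \in A /\
  \big[Rplus/0]_(X in A :&: boundary A (f n)) exp (H X) <=
  exp (- (b * INR n)) * \big[Rplus/0]_(X in A) exp (H X).
Proof.
move=> h HG HG0 Hbeta Hq HPsi Hf.
have C0 := ham_const_ge0 s G beta; set C := ham_const s G beta in C0.
have eta0 : 0 < Psi s G beta q - h by lra.
have [b [b0 [N HN]]] := escape_rate C _ f C0 eta0 Hf.
exists b; split=> //; exists N => n /HN[n1 HC Hk [theta [t0 tk Hexp]]] H A.
have n0 : (0 < n)%N by apply: leq_trans n1.
have Cn0 : 0 <= C / INR n by apply: Rle_mult_inv_pos => //; apply: lt_0_INR; apply/ltP.
have Hmean e : h + 2 * ((Psi s G beta q - h) / 4) <= expect q (gradient H e).
  have := expect_hamiltonian n s G beta q e n0 HG ltac:(lra); rewrite -/C -/H.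
  by split_Rabs; lra.
have [|HA Hsum] := superlevel_boundary H q (C / INR n) C _ theta (f n) Hq
  (hamiltonian_tame n s G beta n0 HG HG0 Hbeta) Cn0 _ t0 Hmean tk Hk; first by lra.
split=> //; apply: Rle_trans Hsum _; apply: Rmult_le_compat_r.
  by apply: bigR_ge0 => X _; apply: Rlt_le; apply: exp_pos.
apply: Rle_trans Hexp; apply: Rmult_le_compat_r; first exact: Rlt_le (exp_pos _).
exact: card_pairs_le.
Qed.

(** * The chains *)

Lemma partition_fn_pos n s G beta : 0 < partition_fn n s G beta.
Proof.
rewrite /partition_fn rsumE (bigD1 set0) //=.
apply: Rplus_lt_le_0_compat; first exact: exp_pos.
by apply: bigR_ge0 => X _; apply: Rlt_le; apply: exp_pos.
Qed.

Lemma sum_gibbs n s G beta (A : {set graph_t n}) :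
  \big[Rplus/0]_(X in A) gibbs n s G beta X =
  \big[Rplus/0]_(X in A) exp (hamiltonian n s G beta X) / partition_fn n s G beta.
Proof. by rewrite /gibbs /Rdiv -big_distrl. Qed.

Lemma gibbs_ge0 n s G beta (X : graph_t n) : 0 <= gibbs n s G beta X.
Proof. by apply: Rle_mult_inv_pos; [apply: Rlt_le; apply: exp_pos | apply: partition_fn_pos]. Qed.

Lemma sum_gibbs1 n s G beta : \big[Rplus/0]_(X : graph_t n) gibbs n s G beta X = 1.
Proof.
rewrite /gibbs /Rdiv -big_distrl /= -rsumE.
apply: Rinv_r; exact: Rgt_not_eq (partition_fn_pos n s G beta).
Qed.

Lemma logistic_bounds x : 0 < logistic x < 1.
Proof.
have E := exp_pos x; rewrite /logistic; split; first by apply: Rdiv_lt_0_compat; lra.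
by apply: (Rmult_lt_reg_r (1 + exp x)); [lra | field_simplify; lra].
Qed.

Lemma card_pairs_pos n : (1 < n)%N -> (0 < #|{: pair_t n}|)%N.
Proof.
case: n => [|[|n]] // _; apply/card_gt0P.
by exists (exist (fun p : 'I_n.+2 * 'I_n.+2 => (p.1 < p.2)%N) (ord0, lift ord0 ord0) isT).
Qed.

Lemma glauber_markov n s G beta : (1 < n)%N -> is_markov (glauber n s G beta).
Proof.
move=> /card_pairs_pos; set N := #|_| => N0.
have N0' : 0 < INR N by apply: lt_0_INR; apply/ltP.
split=> [X Y|X].
  rewrite /glauber rsumE; apply: bigR_ge0 => e _; apply: Rmult_le_pos.
    by apply: Rlt_le; apply: Rinv_0_lt_compat.
  have := logistic_bounds (dH n s G beta X e).
  by case: ifP; case: ifP; lra.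
rewrite rsumE /glauber; under eq_bigr => Y _ do rewrite rsumE.
rewrite exchange_big /= (eq_bigr (fun=> / INR N)).
  by rewrite bigR_constT; apply: Rinv_r; rewrite -/N; lra.
move=> e _; rewrite -big_distrr big_split /= -!big_mkcond !big_pred1_eq /=.
by set L := logistic _; rewrite -/N; ring.
Qed.

Lemma dH_setU1 n s G beta (X : graph_t n) e : dH n s G beta (e |: X) e = dH n s G beta X e.
Proof.
rewrite /dH setUA setUid; congr (_ - hamiltonian _ _ _ _ _).
by apply/setP => f; rewrite !inE; case: eqP.
Qed.

Lemma dH_setD1 n s G beta (X : graph_t n) e : dH n s G beta (X :\ e) e = dH n s G beta X e.
Proof.
rewrite /dH setDDl setUid; congr (hamiltonian _ _ _ _ _ - _).
by apply/setP => f; rewrite !inE; case: eqP.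
Qed.

(** Detailed balance for one pair: the Gibbs ratio [exp (dH)] is exactly the odds of [logistic]. *)
Lemma logistic_balance n s G beta (X : graph_t n) e :
  gibbs n s G beta (e |: X) * (1 - logistic (dH n s G beta X e)) =
  gibbs n s G beta (X :\ e) * logistic (dH n s G beta X e).
Proof.
rewrite /gibbs /logistic /dH.
set a := hamiltonian _ _ _ _ (e |: X); set b := hamiltonian _ _ _ _ (X :\ e).
have -> : exp a = exp b * exp (a - b) by rewrite -exp_plus; congr exp; lra.
have := exp_pos (a - b); have := partition_fn_pos n s G beta; set Z := partition_fn _ _ _ _ => Z0 E.
by field; lra.
Qed.

(** The update at each fixed pair already preserves the Gibbs measure, and the dynamics averages
    these updates. *)
Lemma glauber_stationary n s G beta : (1 < n)%N ->
  stationary (glauber n s G beta) (gibbs n s G beta).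
Proof.
move=> /card_pairs_pos; set N := #|_| => N0 Y.
have N0' : 0 < INR N by apply: lt_0_INR; apply/ltP.
rewrite rsumE /glauber.
under eq_bigr => X _ do rewrite rsumE -/N big_distrr /=.
rewrite exchange_big /= (eq_bigr (fun=> / INR N * gibbs n s G beta Y)).
  by rewrite bigR_constT -/N; field; lra.
move=> e _; set pi := gibbs n s G beta; set L := fun X => logistic (dH n s G beta X e).
rewrite (eq_bigr (fun X => / INR N * (pi X * ((if Y == e |: X then L X else 0) +
  (if Y == X :\ e then 1 - L X else 0))))); last first.
  by move=> X _; have swap a b c : a * (b * c) = b * (a * c) by ring; exact: swap.
rewrite -big_distrr /=; congr (_ * _).
have ne : e |: Y != Y :\ e.
  by apply/eqP => /setP/(_ e); rewrite !inE eqxx.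
(* An update at [e] reaches [Y] only from [e |: Y] or [Y :\ e]. *)
rewrite (bigD1 (e |: Y)) //= (bigD1 (Y :\ e)) 1?eq_sym //= big1; last first.
  move=> X /andP[X1 X0]; case: eqP => [E|_].
    case/orP: (orbN (e \in X)) => eX.
      by case/eqP: X1; rewrite E; apply/setP => f; rewrite !inE; case: eqP => [->|].
    by case/eqP: X0; rewrite E; apply/setP => f; rewrite !inE;
    case: eqP => [->|]; rewrite ?(negbTE eX).
  case: eqP => [E|_]; last by lra.
  case/orP: (orbN (e \in X)) => eX.
    by case/eqP: X1; rewrite E; apply/setP => f; rewrite !inE; case: eqP => [->|].
  by case/eqP: X0; rewrite E; apply/setP => f; rewrite !inE;
    case: eqP => [->|]; rewrite ?(negbTE eX).
rewrite /L dH_setU1 dH_setD1 -/(L Y).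
have -> : e |: (e |: Y) = e |: Y by rewrite setUA setUid.
have -> : (e |: Y) :\ e = Y :\ e by apply/setP => f; rewrite !inE; case: eqP.
have -> : e |: (Y :\ e) = e |: Y by apply/setP => f; rewrite !inE; case: eqP.
have -> : Y :\ e :\ e = Y :\ e by rewrite setDDl setUid.
have := logistic_balance n s G beta Y e; rewrite -/pi -/(L Y) => bal.
case eY: (e \in Y).
  have Y1 : e |: Y = Y by apply/setUidPr; rewrite sub1set.
  move: ne bal; rewrite Y1 eqxx => /negbTE -> bal.
  have K a b l : a * (1 - l) = b * l -> a * (l + 0) + (b * (l + 0) + 0) = a by lra.
  exact: K bal.
have Y0 : Y :\ e = Y by apply/setDidPl; rewrite disjoint_sym disjoints1 eY.
move: ne bal; rewrite Y0 eqxx => ne bal; rewrite (negbTE ne) [Y == e |: Y]eq_sym (negbTE ne).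
have K a b l : a * (1 - l) = b * l -> a * (0 + (1 - l)) + (b * (0 + (1 - l)) + 0) = b by lra.
exact: K bal.
Qed.

Lemma glauber_local n s G beta : local_chain (glauber n s G beta) 1.
Proof.
move=> X Y; rewrite /glauber rsumE => Hpos.
have [e He|H] := pickP (fun e : pair_t n => (Y == e |: X) || (Y == X :\ e)).
  rewrite -(cards1 e); apply: subset_leq_card; apply/subsetP => f; rewrite !inE.
  by case/orP: He => /eqP ->; rewrite !inE; case: eqP; case: (f \in X).
move: Hpos; rewrite big1; first by move=> /Rlt_irrefl.
by move=> e _; have /norP[/negbTE -> /negbTE ->] := negbT (H e); ring.
Qed.

(** * From stable fixed points to the mixing time bound *)

Lemma logistic_lt (x q : R) : 0 < q < 1 -> logistic x < q -> x < ln (q / (1 - q)).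
Proof.
move=> Hq H; have E := exp_pos x; have q0 : 0 < q / (1 - q) by apply: Rdiv_lt_0_compat; lra.
apply: exp_lt_inv; rewrite exp_ln //.
have H1 : exp x < q * (1 + exp x).
  have E2 : logistic x * (1 + exp x) = exp x by rewrite /logistic; field; lra.
  by rewrite -[X in X < _]E2; apply: Rmult_lt_compat_r; lra.
apply: (Rmult_lt_reg_r (1 - q)); first lra.
have -> : q / (1 - q) * (1 - q) = q by field; lra.
by lra.
Qed.

Lemma logistic_gt (x q : R) : 0 < q < 1 -> q < logistic x -> ln (q / (1 - q)) < x.
Proof.
move=> Hq H; have E := exp_pos x; have q0 : 0 < q / (1 - q) by apply: Rdiv_lt_0_compat; lra.
apply: exp_lt_inv; rewrite exp_ln //.
have H1 : q * (1 + exp x) < exp x.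
  have E2 : logistic x * (1 + exp x) = exp x by rewrite /logistic; field; lra.
  by rewrite -[X in _ < X]E2; apply: Rmult_lt_compat_r; lra.
apply: (Rmult_lt_reg_r (1 - q)); first lra.
have -> : q / (1 - q) * (1 - q) = q by field; lra.
by lra.
Qed.

(** With tolerance [1 - d], difference quotients at [p] are below [1], so the graph lies under the
    diagonal just to the right of [p]. *)
Lemma stable_right (f : R -> R) p d r :
  f p = p -> derivable_pt_lim f p d -> d < 1 -> p < r ->
  exists q, p < q < r /\ f q < q.
Proof.
move=> fp Hd d1 pr; have [[del del0] Hdel] := Hd (1 - d) ltac:(lra).
have m0 : 0 < Rmin del (r - p) by apply: Rmin_glb_lt; lra.
have m1 := Rmin_l del (r - p); have m2 := Rmin_r del (r - p).
set h := Rmin del (r - p) / 2.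
have := Hdel h ltac:(rewrite /h; lra) ltac:(rewrite /h /= Rabs_pos_eq; lra).
rewrite fp => H; exists (p + h); split; first by rewrite /h; lra.
have {}H : (f (p + h) - p) / h < 1 by split_Rabs; lra.
have h0 : 0 < h by rewrite /h; lra.
have := Rmult_lt_compat_r h _ _ h0 H.
have -> : (f (p + h) - p) / h * h = f (p + h) - p by field; lra.
by lra.
Qed.

Lemma stable_left (f : R -> R) p d r :
  f p = p -> derivable_pt_lim f p d -> d < 1 -> r < p ->
  exists q, r < q < p /\ q < f q.
Proof.
move=> fp Hd d1 rp; have [[del del0] Hdel] := Hd (1 - d) ltac:(lra).
have m0 : 0 < Rmin del (p - r) by apply: Rmin_glb_lt; lra.
have m1 := Rmin_l del (p - r); have m2 := Rmin_r del (p - r).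
set h := Rmin del (p - r) / 2.
have := Hdel (- h) ltac:(rewrite /h; lra) ltac:(rewrite /h /= Rabs_Ropp Rabs_pos_eq; lra).
rewrite fp => H; exists (p + - h); split; first by rewrite /h; lra.
have {}H : (f (p + - h) - p) / - h < 1 by split_Rabs; lra.
have h0 : 0 < h by rewrite /h; lra.
have := Rmult_lt_compat_r h _ _ h0 H.
have -> : (f (p + - h) - p) / - h * h = p - f (p + - h) by field; lra.
by lra.
Qed.

(** The point [q2] is sought between [q1] and the larger fixed point, which orders the two levels
    and keeps both strictly inside the unit interval. *)
Lemma low_temperature_gap s G beta : low_temperature s G beta ->
  exists q1 q2, [/\ 0 < q1, q1 < q2, q2 < 1,
    Psi s G beta q1 < ln (q1 / (1 - q1)) & ln (q2 / (1 - q2)) < Psi s G beta q2].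
Proof.
move=> [p1 [p2 [ne [S1 S2]]]].
wlog lt : p1 p2 ne S1 S2 / p1 < p2.
  move=> W; have [lt|lt] : p1 < p2 \/ p2 < p1 by lra.
    exact: W lt.
  by apply: (W p2 p1) => // E; apply: ne.
case: S1 => r1 [f1 [d1 [D1 l1]]]; case: S2 => r2 [f2 [d2 [D2 l2]]].
have [q1 [Hq1 Hf1]] := stable_right _ _ _ _ f1 D1 l1 lt.
have [q2 [Hq2 Hf2]] := stable_left _ _ _ q1 f2 D2 l2 (proj2 Hq1).
exists q1, q2; split; try lra.
  by apply: logistic_lt => //; lra.
by apply: logistic_gt => //; lra.
Qed.

Lemma local_chain_boundary {n : nat} (P : graph_t n -> graph_t n -> R) k (A : {set graph_t n}) X Y :
  local_chain P k -> X \in A -> Y \notin A -> 0 < P X Y -> X \in boundary A k.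
Proof. by move=> HP _ YA /HP HXY; rewrite inE; apply/existsP; exists Y; rewrite YA. Qed.

(** At a mixed time [t], [bottleneck] gives each of the two disjoint sets mass at least
    [1 - t * exp (- b n) - exp (-1)]. Since the masses add up to at most [1], [t * exp (- b n)] is
    at least [/ 2 - exp (-1)]. *)
Lemma slow_mixing_local s G beta (f : nat -> nat) :
  (forall i, (i < s)%N -> simple_graph (G i)) -> G 0%nat = K2 ->
  (forall i, (1 <= i < s)%N -> 0 < beta i) ->
  low_temperature s G beta -> little_o_n f ->
  exists a : R, 0 < a /\ exists N : nat, forall n : nat, (N <= n)%N -> (1 < n)%N /\
    forall P : graph_t n -> graph_t n -> R,
      is_markov P -> stationary P (gibbs n s G beta) -> local_chain P (f n) ->
      forall t : nat, mixed_at P (gibbs n s G beta) t -> exp (a * INR n) <= INR t.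
Proof.
move=> HG HG0 Hbeta /low_temperature_gap[q1 [q2 [q10 q12 q21 HP1 HP2]]] Hf.
have [b1 [b10 [N1 HN1]]] := sublevel_escape s G beta q1 f HG HG0 Hbeta ltac:(lra) HP1 Hf.
have [b2 [b20 [N2 HN2]]] := superlevel_escape s G beta q2 f HG HG0 Hbeta ltac:(lra) HP2 Hf.
set h1 := ln (q1 / _) in HP1 HN1; set h2 := ln (q2 / _) in HP2 HN2.
have h12 : h1 < h2.
  apply: ln_increasing; first by apply: Rdiv_lt_0_compat; lra.
  apply: (Rmult_lt_reg_r ((1 - q1) * (1 - q2))); first by apply: Rmult_lt_0_compat; lra.
  have -> : q1 / (1 - q1) * ((1 - q1) * (1 - q2)) = q1 * (1 - q2) by field; lra.
  have -> : q2 / (1 - q2) * ((1 - q1) * (1 - q2)) = q2 * (1 - q1) by field; lra.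
  by lra.
set b := Rmin b1 b2.
have b0 : 0 < b by apply: Rmin_glb_lt.
(* This is [exp 1 > 2]. *)
have c0 : 0 < / 2 - exp (-1).
  have inv : exp (-1) * exp 1 = 1 by rewrite -exp_plus Rplus_opp_l exp_0.
  by have := Rmult_lt_compat_l _ _ _ (exp_pos (-1)) (exp_ineq1 1 R1_neq_R0); rewrite inv; lra.
set c := / 2 - exp (-1) in c0.
(* Beyond this threshold [c * exp (b / 2 * n)] is at least [1], so the constant [c] costs half of
   the rate. *)
have [N3 HN3] := INR_unbounded (2 / (b * c)).
exists (b / 2); split; first by lra.
exists (2 + (N1 + (N2 + N3)))%N => n Hn.
have n2 : (2 <= n)%N by apply: leq_trans Hn; apply: leq_addr.
have n1 : (N1 <= n)%N by apply: leq_trans Hn; rewrite addnCA leq_addr.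
have nN2 : (N2 <= n)%N by apply: leq_trans Hn; rewrite addnA addnCA leq_addr.
have nN3 : (N3 <= n)%N by apply: leq_trans Hn; rewrite !addnA leq_addl.
split=> // P HP Hst Hloc t Hmix.
have n0 := pos_INR n.
set pi := gibbs n s G beta in Hst Hmix *.
have Z0 := partition_fn_pos n s G beta.
have side (A : {set graph_t n}) (X0 : graph_t n) b' : b <= b' -> X0 \in A ->
    \big[Rplus/0]_(X in A :&: boundary A (f n)) exp (hamiltonian n s G beta X) <=
    exp (- (b' * INR n)) * \big[Rplus/0]_(X in A) exp (hamiltonian n s G beta X) ->
    1 - INR t * exp (- (b * INR n)) - exp (-1) <= \big[Rplus/0]_(X in A) pi X.
  move=> bb' X0A Hsum.
  apply: (bottleneck P pi A (boundary A (f n))) => //.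
  - by move=> X; apply: gibbs_ge0.
  - exact: sum_gibbs1.
  - by move=> X Y; apply: local_chain_boundary.
  - rewrite sum_gibbs; apply: Rdiv_lt_0_compat => //; rewrite (bigD1 X0) //=.
    apply: Rplus_lt_le_0_compat; first exact: exp_pos.
    by apply: bigR_ge0 => X _; apply: Rlt_le; apply: exp_pos.
  - rewrite !sum_gibbs /Rdiv -Rmult_assoc.
    apply: Rmult_le_compat_r; first by apply: Rlt_le; apply: Rinv_0_lt_compat.
    apply: Rle_trans Hsum _; apply: Rmult_le_compat_r.
      by apply: bigR_ge0 => X _; apply: Rlt_le; apply: exp_pos.
    by apply: exp_le_mono; nra.
have [A1 S1] := HN1 n n1; have [A2 S2] := HN2 n nN2.
have H1 := side _ _ b1 (Rmin_l _ _) A1 S1.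
have H2 := side _ _ b2 (Rmin_r _ _) A2 S2.
set B1 := sublevel _ _ in H1; set B2 := superlevel _ _ in H2.
(* Since [n] is at least [2] some pair exists, and its gradient cannot be both at most [h1] and at
   least [h2]. *)
have H12 : \big[Rplus/0]_(X in B1) pi X + \big[Rplus/0]_(X in B2) pi X <= 1.
  rewrite -(sum_gibbs1 n s G beta) [X in _ <= X](bigID (mem B1)) /=.
  apply: Rplus_le_compat_l; apply: bigR_sub_pred; last by move=> X _; apply: gibbs_ge0.
  move=> X; rewrite !inE => /forallP HX2; apply/negP => /forallP HX1.
  have /card_gt0P[e _] := card_pairs_pos n n2.
  by have /RlebP := HX1 e; have /RlebP := HX2 e; lra.
have Ht : c <= INR t * exp (- (b * INR n)) by rewrite /c; lra.
have Hc : 1 <= c * exp (b / 2 * INR n).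
  have Hn3 : 2 / (b * c) <= INR n by have := INR_leq _ _ nN3; lra.
  have bc : 0 < b * c by nra.
  have := Rmult_le_compat_l _ _ _ (Rlt_le _ _ bc) Hn3.
  have -> : b * c * (2 / (b * c)) = 2 by field; nra.
  by have := exp_ineq1_le (b / 2 * INR n); nra.
have -> : INR t = INR t * exp (- (b * INR n)) * exp (b * INR n).
  by rewrite Rmult_assoc -exp_plus Rplus_opp_l exp_0 Rmult_1_r.
have -> : exp (b * INR n) = exp (b / 2 * INR n) * exp (b / 2 * INR n).
  by rewrite -exp_plus; congr exp; lra.
have E := exp_pos (b / 2 * INR n).
by nra.
Qed.

Theorem theorem2 (s : nat) (G : nat -> sgraph) (beta : nat -> R)
  (Hs : (1 <= s)%N)
  (HG : forall i, (i < s)%N -> simple_graph (G i))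
  (HG0 : G 0%nat = K2)
  (Hbeta : forall i, (1 <= i < s)%N -> (0 < beta i))
  (Hlow : low_temperature s G beta) :
  (exists a : R, (0 < a) /\ exists N : nat, forall n : nat, (N <= n)%N ->
     forall t : nat, is_mixing_time (glauber n s G beta) (gibbs n s G beta) t ->
       (exp (a * INR n) <= INR t))
  /\
  (forall f : nat -> nat, little_o_n f ->
   exists a : R, (0 < a) /\ exists N : nat, forall n : nat, (N <= n)%N ->
     forall P : graph_t n -> graph_t n -> R,
       is_markov P -> stationary P (gibbs n s G beta) -> local_chain P (f n) ->
       forall t : nat, is_mixing_time P (gibbs n s G beta) t ->
         (exp (a * INR n) <= INR t)).
Proof.
split=> [|f Hf].
  (* A Glauber step changes at most one edge, so the constant bound [1] applies. *)
  have Hf : little_o_n (fun=> 1%N).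
    move=> eps eps0; have [N HN] := INR_unbounded (/ eps); exists N => n /INR_leq Hn.
    have H : / eps <= INR n by lra.
    have := Rmult_le_compat_l _ _ _ (Rlt_le _ _ eps0) H.
    by rewrite Rinv_r /=; lra.
  have [a [a0 [N HN]]] := slow_mixing_local s G beta _ HG HG0 Hbeta Hlow Hf.
  exists a; split=> //; exists N => n /HN[n1 H] t [Ht _].
  by apply: (H _ (glauber_markov n s G beta n1) (glauber_stationary n s G beta n1)) Ht;
    apply: glauber_local.
have [a [a0 [N HN]]] := slow_mixing_local s G beta f HG HG0 Hbeta Hlow Hf.
exists a; split=> //; exists N => n /HN[_ H] P HP Hst Hloc t [Ht _].
exact: (H P).
Qed.
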